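(* Let $k$ be an algebraically closed field, $d\geqslant 1$ an integer, and $\mathscr{T}$ a $k$-linear $\operatorname{Hom}$-finite $(d+2)$-angulated category with split idempotents which is $2d$-Calabi--Yau. Let $T\in\mathscr{T}$ be an Oppermann--Thomas cluster tilting object, $\Gamma=\operatorname{End}_{\mathscr{T}}(T)$, and let $\mathscr{D}$ be the essential image of the functor $\mathscr{T}(T,-):\mathscr{T}\to\operatorname{mod}\Gamma$. If each indecomposable object of $\mathscr{T}$ is $d$-rigid, then there is a bijection $$\{\text{isomorphism classes of maximal } d\text{-rigid objects in }\mathscr{T}\}\longrightarrow\{\text{isomorphism classes of maximal }\tau_d\text{-rigid pairs in }\mathscr{D}\}.$$
   Context: $(d+2)$-angulated category: Put $n=d+2$. For an additive category $\mathscr{T}$ with an automorphism $\Sigma^d$ (the $d$-suspension; $\Sigma^{-d}=(\Sigma^d)^{-1}$, $\Sigma^{2d}=\Sigma^d\Sigma^d$), consider sequences $X_1\xrightarrow{\alpha_1}X_2\to\cdots\to X_n\xrightarrow{\alpha_n}\Sigma^dX_1$; a morphism of such sequences is a tuple $(\varphi_1,\dots,\varphi_n)$ making the ladder with last vertical map $\Sigma^d\varphi_1$ commute. $\mathscr{T}$ is $(d+2)$-angulated if it is equipped with a class of such sequences, called $(d+2)$-angles, such that: (F1) the class is closed under isomorphisms, direct sums and direct summands, contains $X\xrightarrow{1}X\to0\to\cdots\to0\to\Sigma^dX$ for each $X$, and each morphism is the first morphism $\alpha_1$ of some $(d+2)$-angle; (F2) a sequence is a $(d+2)$-angle iff its rotation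 $X_2\xrightarrow{\alpha_2}\cdots\to X_n\xrightarrow{\alpha_n}\Sigma^dX_1\xrightarrow{(-1)^n\Sigma^d\alpha_1}\Sigma^dX_2$ is; (F3) given two $(d+2)$-angles $(X_i,\alpha_i)$, $(Y_i,\beta_i)$ and $\varphi_1,\varphi_2$ with $\varphi_2\alpha_1=\beta_1\varphi_1$, there are $\varphi_3,\dots,\varphi_n$ completing these to a morphism; (F4) in (F3) the $\varphi_3,\dots,\varphi_n$ can be chosen so that the cone $X_2\oplus Y_1\to X_3\oplus Y_2\to\cdots\to\Sigma^dX_1\oplus Y_n\to\Sigma^dX_2\oplus\Sigma^dY_1$, with maps $\begin{pmatrix}-\alpha_{i+1}&0\\ \varphi_{i+1}&\beta_i\end{pmatrix}$ (where index $n+1$ means $\Sigma^d$ of index $1$), is a $(d+2)$-angle. $\mathscr{T}(X,Y)$ denotes the $\operatorname{Hom}$ space, $\operatorname{Ext}^d_{\mathscr{T}}(X,Y)=\mathscr{T}(X,\Sigma^dY)$, and $\operatorname{add}X$ is the class of direct summands of finite direct sums of copies of $X$. $\mathscr{T}$ is $2d$-Calabi--Yau if $\mathscr{T}(X,Y)\cong \operatorname{Hom}_k(\mathscr{T}(Y,\Sigma^{2d}X),k)$ naturally in $X,Y\in\mathscr{T}$. $X$ is $d$-rigid if $\operatorname{Ext}^d_{\mathscr{T}}(X,X)=0$. $X$ is Oppermann--Thomas cluster tilting in $\mathscr{T}$ if $X$ is $d$-rigid and for any $Y\in\mathscr{T}$ there exists a $(d+2)$-angle $X_d\to\cdots\to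 X_0\to Y\to\Sigma^dX_d$ with $X_i\in\operatorname{add}X$ for all $0\leq i\leq d$. $X$ is maximal $d$-rigid in $\mathscr{T}$ if $\operatorname{add}X=\{Y\in\mathscr{T}\mid\operatorname{Ext}^d_{\mathscr{T}}(X\oplus Y,X\oplus Y)=0\}$. $\operatorname{mod}\Gamma$ is the category of finitely generated right $\Gamma$-modules ($\Gamma$ is a finite-dimensional $k$-algebra), $\operatorname{proj}\Gamma$ its full subcategory of projectives, $\nu_\Gamma=\operatorname{Hom}_k(\operatorname{Hom}_\Gamma(-,\Gamma),k)$ the Nakayama functor. $\tau_d$ is the $d$-Auslander--Reiten translation: if $P_d\to P_{d-1}\to\cdots\to P_0\to M\to0$ is the start of the augmented minimal projective resolution of $M$, then $\tau_dM=\ker(\nu_\Gamma P_d\to\nu_\Gamma P_{d-1})$. A pair $(M,P)$ with $M\in\mathscr{D}$ and $P\in\operatorname{proj}\Gamma$ is a maximal $\tau_d$-rigid pair in $\mathscr{D}$ if: (i) for each $N\in\mathscr{D}$, one has $N\in\operatorname{add}M$ if and only if $\operatorname{Hom}_\Gamma(M,\tau_dN)=0$, $\operatorname{Hom}_\Gamma(N,\tau_dM)=0$ and $\operatorname{Hom}_\Gamma(P,N)=0$; and (ii) for each $Q\in\operatorname{proj}\Gamma$, one has $Q\in\operatorname{add}P$ if and only if $\operatorname{Hom}_\Gamma(Q,M)=0$. Two pairs are isomorphic if they are componentwise isomorphic. *)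

(* Defs.v *)
From HB Require Import structures.
From mathcomp Require Import all_boot all_algebra.

(* MathComp has no category theory, and its k-algebras (algType, falgType) are
   nontrivial rings, whereas the endomorphism algebra of a zero object is the
   zero ring; both notions are therefore set up here on top of vectType, the
   finite-dimensional k-vector spaces. *)

Set Implicit Arguments.
Unset Strict Implicit.
Unset Printing Implicit Defensive.

Import GRing.Theory.
Local Open Scope ring_scope.

Reserved Notation "g \oc f" (at level 40, left associativity).
Reserved Notation "X \(+) Y" (at level 50, left associativity).

Lemma linfunE (k : fieldType) (V W : vectType k) (f : V -> W) :
  linear f -> linfun f =1 f.
Proof.
move=> lf.
pose m := GRing.isLinear.Build k V W *:%R f lf.
pose F : {linear V -> W} := HB.pack f m.
exact: (lfunE F).
Qed.

(* k-linear Hom-finite additive categories.  Hom-finiteness is the choice of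
   vectType for the Hom spaces; a zero object and binary biproducts are chosen. *)

Record addcat (k : fieldType) := AddCat {
  Obj :> Type;
  hom : Obj -> Obj -> vectType k;
  idm : forall X, hom X X;
  compm : forall X Y Z, hom Y Z -> hom X Y -> hom X Z;
  compmA : forall X Y Z W (h : hom Z W) (g : hom Y Z) (f : hom X Y),
    compm h (compm g f) = compm (compm h g) f;
  comp1m : forall X Y (f : hom X Y), compm (idm Y) f = f;
  compm1 : forall X Y (f : hom X Y), compm f (idm X) = f;
  compm_linl : forall X Y Z (f : hom X Y),
    linear (fun g : hom Y Z => compm g f);
  compm_linr : forall X Y Z (g : hom Y Z),
    linear (fun f : hom X Y => compm g f);
  zob : Obj;
  zobP : idm zob = 0;
  bip : Obj -> Obj -> Obj;
  inl_ : forall X Y, hom X (bip X Y);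
  inr_ : forall X Y, hom Y (bip X Y);
  prl : forall X Y, hom (bip X Y) X;
  prr : forall X Y, hom (bip X Y) Y;
  prl_inl : forall X Y, compm (prl X Y) (inl_ X Y) = idm X;
  prr_inr : forall X Y, compm (prr X Y) (inr_ X Y) = idm Y;
  bip_split : forall X Y,
    compm (inl_ X Y) (prl X Y) + compm (inr_ X Y) (prr X Y) = idm (bip X Y)
}.

Arguments idm {k a} X.
Arguments zob {k a}.
Arguments inl_ {k a} X Y.
Arguments inr_ {k a} X Y.
Arguments prl {k a} X Y.
Arguments prr {k a} X Y.

Notation "g \oc f" := (compm g f) : ring_scope.
Notation "X \(+) Y" := (bip X Y) : ring_scope.

Section Categories.
Variables (k : fieldType) (C : addcat k).
Implicit Types X Y Z W : C.

(* The matrix ((a, b), (c, e)), first row a b, acting on columns. *)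
Definition mat X Y Z W (a : hom X Z) (b : hom Y Z) (c : hom X W) (e : hom Y W)
    : hom (X \(+) Y) (Z \(+) W) :=
  inl_ Z W \oc (a \oc prl X Y + b \oc prr X Y)
  + inr_ Z W \oc (c \oc prl X Y + e \oc prr X Y).

Definition is_iso X Y (f : hom X Y) : Prop :=
  exists g : hom Y X, g \oc f = idm X /\ f \oc g = idm Y.

Definition iso X Y : Prop := exists f : hom X Y, is_iso f.

Fixpoint copies X (n : nat) : C :=
  if n is n'.+1 then X \(+) copies X n' else zob.

Definition in_add X Y : Prop :=
  exists (n : nat) (Z : C), iso (Y \(+) Z) (copies X n).

Definition is_zero_obj X : Prop := iso X zob.

Definition indecomposable X : Prop :=
  ~ is_zero_obj X /\
  forall Y Z, iso X (Y \(+) Z) -> is_zero_obj Y \/ is_zero_obj Z.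

Definition split_idempotents : Prop :=
  forall X (e : hom X X), e \oc e = e ->
  exists (Y : C) (p : hom X Y) (i : hom Y X), p \oc i = idm Y /\ i \oc p = e.

(* chain m X Y is the type of sequences X -> Z_1 -> ... -> Z_m -> Y of m + 1
   composable morphisms, with no condition on the composites. *)
Fixpoint chain (m : nat) (X Y : C) : Type :=
  if m is m'.+1 then {Z : C & (hom X Z * chain m' Z Y)%type} else hom X Y.

Definition link m X Y Z (f : hom X Z) (c : chain m Z Y) : chain m.+1 X Y :=
  existT _ Z (f, c).

Fixpoint snoc m X Y Z : chain m X Y -> hom Y Z -> chain m.+1 X Z :=
  match m return chain m X Y -> hom Y Z -> chain m.+1 X Z with
  | 0 => fun f g => link (m := 0) f g
  | m'.+1 => fun c g => link (projT2 c).1 (snoc (projT2 c).2 g)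
  end.

(* Composes the last morphism of the chain with g. *)
Fixpoint postcomp m X Y Z : chain m X Y -> hom Y Z -> chain m X Z :=
  match m return chain m X Y -> hom Y Z -> chain m X Z with
  | 0 => fun f g => g \oc f
  | m'.+1 => fun c g => link (projT2 c).1 (postcomp (projT2 c).2 g)
  end.

Fixpoint zero_chain m X Y : chain m X Y :=
  match m return chain m X Y with
  | 0 => 0
  | m'.+1 => link (0 : hom X zob) (zero_chain m' zob Y)
  end.

Fixpoint sum_chain m X Y X' Y' :
    chain m X Y -> chain m X' Y' -> chain m (X \(+) X') (Y \(+) Y') :=
  match m return chain m X Y -> chain m X' Y' ->
    chain m (X \(+) X') (Y \(+) Y') with
  | 0 => fun f f' => mat f 0 0 f'
  | m'.+1 => fun c c' =>
      link (mat (projT2 c).1 0 0 (projT2 c').1)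
           (sum_chain (projT2 c).2 (projT2 c').2)
  end.

(* Every object of the chain except its final target Y satisfies P. *)
Fixpoint all_sources (P : C -> Prop) m X Y : chain m X Y -> Prop :=
  match m return chain m X Y -> Prop with
  | 0 => fun _ => P X
  | m'.+1 => fun c => P X /\ all_sources P (projT2 c).2
  end.

(* Vertical maps between the interior objects of two parallel chains. *)
Fixpoint rungs m X Y X' Y' : chain m X Y -> chain m X' Y' -> Type :=
  match m return chain m X Y -> chain m X' Y' -> Type with
  | 0 => fun _ _ => unit
  | m'.+1 => fun c c' =>
      (hom (projT1 c) (projT1 c') * rungs (projT2 c).2 (projT2 c').2)%type
  end.

(* All squares commute, u and v being the outer vertical maps. *)
Fixpoint ladder m X Y X' Y' : forall (c : chain m X Y) (c' : chain m X' Y'),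
    hom X X' -> rungs c c' -> hom Y Y' -> Prop :=
  match m return forall (c : chain m X Y) (c' : chain m X' Y'),
    hom X X' -> rungs c c' -> hom Y Y' -> Prop with
  | 0 => fun f f' u _ v => v \oc f = f' \oc u
  | m'.+1 => fun c c' u r v =>
      r.1 \oc (projT2 c).1 = (projT2 c').1 \oc u /\ ladder r.1 r.2 v
  end.

Fixpoint iso_rungs m X Y X' Y' : forall (c : chain m X Y) (c' : chain m X' Y'),
    rungs c c' -> Prop :=
  match m return forall (c : chain m X Y) (c' : chain m X' Y'),
    rungs c c' -> Prop with
  | 0 => fun _ _ _ => True
  | m'.+1 => fun c c' r => is_iso r.1 /\ iso_rungs r.2
  end.

(* For a ladder (u, r, v) from  c : X -> Z_1 -> ... -> Z_m -> Y  to
   c' : X' -> Z'_1 -> ... -> Z'_m -> Y',  and for  b : W -> X',  a : Y -> Z,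
   the sequence
     X (+) W -> Z_1 (+) X' -> ... -> Y (+) Z'_m -> Z (+) Y'
   whose i-th map, 0 <= i <= m + 1, is ((- c_i, 0), (r_i, c'_{i-1})), where c_{m+1} = a
   and c'_{-1} = b, and where r_0 = u and r_{m+1} = v. *)
Fixpoint cone_chain m X Y X' Y' W Z :
    forall (c : chain m X Y) (c' : chain m X' Y'),
      hom X X' -> rungs c c' -> hom Y Y' -> hom W X' -> hom Y Z ->
    chain m.+1 (X \(+) W) (Z \(+) Y') :=
  match m return forall (c : chain m X Y) (c' : chain m X' Y'),
      hom X X' -> rungs c c' -> hom Y Y' -> hom W X' -> hom Y Z ->
    chain m.+1 (X \(+) W) (Z \(+) Y') with
  | 0 => fun f f' u _ v b a =>
      link (m := 0) (mat (- f) 0 u b) (mat (- a) 0 v f')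
  | m'.+1 => fun c c' u r v b a =>
      link (mat (- (projT2 c).1) 0 u b)
           (cone_chain r.1 r.2 v (projT2 c').1 a)
  end.

End Categories.

(* A (d+2)-angulated structure.  With n = d + 2, a sequence
   X_1 -> X_2 -> ... -> X_n -> Sigma^d X_1 is a chain of d + 2 morphisms from
   X_1 to Sigma^d X_1, that is, an element of chain d.+1 X_1 (Sigma^d X_1), and
   susp is the d-suspension Sigma^d.  An automorphism of a category is a functor
   that is bijective on objects and on Hom sets; it is k-linear, as usual in the
   k-linear setting. *)

Section Angulated.
Variables (k : fieldType) (C : addcat k).

Section Sequences.
Variables (susp : C -> C).
Variable suspm : forall X Y : C, hom X Y -> hom (susp X) (susp Y).
Variable d : nat.

Definition nseq (X : C) : Type := chain d.+1 X (susp X).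

Definition rotate (X : C) (c : nseq X) : nseq (projT1 c) :=
  snoc (projT2 c).2 ((-1) ^+ d.+2 *: suspm (projT2 c).1).

(* The identification of Sigma X (+) Sigma Y with Sigma (X (+) Y). *)
Definition susp_bip (X Y : C) : hom (susp X \(+) susp Y) (susp (X \(+) Y)) :=
  suspm (inl_ X Y) \oc prl (susp X) (susp Y)
  + suspm (inr_ X Y) \oc prr (susp X) (susp Y).

Definition sum_seq (X Y : C) (c : nseq X) (c' : nseq Y) : nseq (X \(+) Y) :=
  postcomp (sum_chain c c') (susp_bip X Y).

Definition iso_seq (X Y : C) (c : nseq X) (c' : nseq Y) : Prop :=
  exists (f : hom X Y) (r : rungs c c'),
    [/\ is_iso f, iso_rungs r & ladder f r (suspm f)].

Definition trivial_seq (X : C) : nseq X :=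
  link (idm X) (zero_chain d X (susp X)).

(* The cone of the morphism (f1, f2, r) from  X1 -a1-> X2 -c-> Sigma X1  to
   Y1 -b1-> Y2 -c'-> Sigma Y1. *)
Definition cone_seq (X1 X2 Y1 Y2 : C) (a1 : hom X1 X2) (b1 : hom Y1 Y2)
    (c : chain d X2 (susp X1)) (c' : chain d Y2 (susp Y1))
    (f1 : hom X1 Y1) (f2 : hom X2 Y2) (r : rungs c c') : nseq (X2 \(+) Y1) :=
  postcomp (cone_chain f2 r (suspm f1) b1 (suspm a1)) (susp_bip X2 Y1).

End Sequences.

Record angulation (d : nat) := Angulation {
  susp : C -> C;
  suspm : forall X Y, hom X Y -> hom (susp X) (susp Y);
  suspm_id : forall X, suspm (idm X) = idm (susp X);
  suspm_comp : forall X Y Z (g : hom Y Z) (f : hom X Y),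
    suspm (g \oc f) = suspm g \oc suspm f;
  suspm_lin : forall X Y, linear (@suspm X Y);
  susp_bij : bijective susp;
  suspm_bij : forall X Y, bijective (@suspm X Y);
  angle : forall X, nseq susp d X -> Prop;
  angle_iso : forall X Y (c : nseq susp d X) (c' : nseq susp d Y),
    iso_seq suspm c c' -> angle c -> angle c';
  angle_sum : forall X Y (c : nseq susp d X) (c' : nseq susp d Y),
    angle c -> angle c' -> angle (sum_seq suspm c c');
  angle_summand : forall X Y (c : nseq susp d X) (c' : nseq susp d Y),
    angle (sum_seq suspm c c') -> angle c;
  angle_trivial : forall X, angle (trivial_seq susp d X);
  angle_first : forall X Y (f : hom X Y),
    exists c : chain d Y (susp X), angle (link f c);
  angle_rotate : forall X (c : nseq susp d X),
    angle c <-> angle (rotate suspm c);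
  angle_morph : forall X1 X2 Y1 Y2 (a1 : hom X1 X2) (b1 : hom Y1 Y2)
      (c : chain d X2 (susp X1)) (c' : chain d Y2 (susp Y1))
      (f1 : hom X1 Y1) (f2 : hom X2 Y2),
    angle (link a1 c) -> angle (link b1 c') -> f2 \oc a1 = b1 \oc f1 ->
    exists r : rungs c c', ladder f2 r (suspm f1);
  angle_cone : forall X1 X2 Y1 Y2 (a1 : hom X1 X2) (b1 : hom Y1 Y2)
      (c : chain d X2 (susp X1)) (c' : chain d Y2 (susp Y1))
      (f1 : hom X1 Y1) (f2 : hom X2 Y2),
    angle (link a1 c) -> angle (link b1 c') -> f2 \oc a1 = b1 \oc f1 ->
    exists r : rungs c c',
      ladder f2 r (suspm f1) /\ angle (cone_seq suspm a1 b1 f1 f2 r)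
}.

Variables (d : nat) (S : angulation d).

Definition Ext_zero (X Y : C) : Prop := forall f : hom X (susp S Y), f = 0.

Definition d_rigid (X : C) : Prop := Ext_zero X X.

Definition OT_cluster_tilting (X : C) : Prop :=
  d_rigid X /\
  forall Y : C, exists (Xd : C) (c : chain d Xd Y) (h : hom Y (susp S Xd)),
    all_sources (in_add X) c /\ angle (snoc c h : nseq (susp S) d Xd).

Definition maximal_d_rigid (X : C) : Prop :=
  forall Y : C, in_add X Y <-> Ext_zero (X \(+) Y) (X \(+) Y).

(* Natural k-linear isomorphisms
   hom X Y ~ Hom_k (hom Y (Sigma^2d X), k). *)
Definition calabi_yau_2d : Prop :=
  exists theta : forall X Y : C,
      'Hom(hom X Y, 'Hom(hom Y (susp S (susp S X)), k^o)),
  [/\ forall X Y, bijective (theta X Y),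
      forall X Y Y' (g : hom Y Y') (f : hom X Y)
          (h : hom Y' (susp S (susp S X))),
        theta X Y' (g \oc f) h = theta X Y f (h \oc g)
    & forall X X' Y (x : hom X' X) (f : hom X Y)
          (h : hom Y (susp S (susp S X'))),
        theta X' Y (f \oc x) h = theta X Y f (suspm S (suspm S x) \oc h)].

End Angulated.

(* Finite-dimensional unital associative k-algebras, possibly zero. *)

Record fdalg (k : fieldType) := FdAlg {
  acar :> vectType k;
  amul : acar -> acar -> acar;
  aone : acar;
  amulA : forall a b c, amul a (amul b c) = amul (amul a b) c;
  amul1l : forall a, amul aone a = a;
  amul1r : forall a, amul a aone = a;
  amul_linl : forall b, linear (amul^~ b);
  amul_linr : forall a, linear (amul a)
}.

Definition end_alg (k : fieldType) (C : addcat k) (X : C) : fdalg k :=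
  @FdAlg k (hom X X) (@compm k C X X X) (idm X)
    (fun a b c => compmA a b c) (@comp1m k C X X) (@compm1 k C X X)
    (@compm_linl k C X X X) (@compm_linr k C X X X).

(* Finitely generated right modules: as the algebra is finite-dimensional over
   k, a module is finitely generated if and only if it is finite-dimensional
   over k, so the carrier is a vectType. *)

Record rmod (k : fieldType) (A : fdalg k) := RMod {
  mcar :> vectType k;
  mact : mcar -> A -> mcar;
  mactA : forall x a b, mact x (amul a b) = mact (mact x a) b;
  mact1 : forall x, mact x (aone A) = x;
  mact_linl : forall a, linear (mact^~ a);
  mact_linr : forall x, linear (mact x)
}.

Section Modules.
Variables (k : fieldType) (A : fdalg k).
Implicit Types L M N P Q : rmod A.

Definition equivariant M N (f : 'Hom(M, N)) : Prop :=
  forall x (a : A), f (mact x a) = mact (f x) a.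

(* The subspace of equivariant maps, cut out as a kernel: see equivP. *)
Definition equiv_space M N : {vspace 'Hom(M, N)} :=
  lker (linfun (fun f : 'Hom(M, N) =>
    linfun (fun a : A =>
      ((f \o linfun ((@mact k A M)^~ a)) - (linfun ((@mact k A N)^~ a) \o f))%VF))).

Lemma equivP M N (f : 'Hom(M, N)) : f \in equiv_space M N <-> equivariant f.
Proof.
have lin2 (g : 'Hom(M, N)) : linear (fun a : A =>
    ((g \o linfun ((@mact k A M)^~ a)) - (linfun ((@mact k A N)^~ a) \o g))%VF).
  move=> c a b; apply/lfunP => x.
  rewrite !(add_lfunE, opp_lfunE, scale_lfunE, comp_lfunE) /=.
  rewrite !(linfunE (@mact_linl k A _ _)) !mact_linr linearP.
  by rewrite scalerBr opprD addrACA.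
have lin1 : linear (fun f : 'Hom(M, N) =>
    linfun (fun a : A =>
      ((f \o linfun ((@mact k A M)^~ a)) - (linfun ((@mact k A N)^~ a) \o f))%VF)).
  move=> c g h; apply/lfunP => a; rewrite add_lfunE scale_lfunE.
  rewrite !(linfunE (lin2 _)); apply/lfunP => x.
  rewrite !(add_lfunE, opp_lfunE, scale_lfunE, comp_lfunE) /=.
  rewrite !(linfunE (@mact_linl k A _ _)) mact_linl.
  by rewrite scalerBr opprD addrACA.
rewrite /equiv_space memv_ker (linfunE lin1); split.
  move/eqP/lfunP => f0 x a; have /lfunP/(_ x) := f0 a.
  rewrite (linfunE (lin2 _)) !zero_lfunE.
  rewrite !(add_lfunE, opp_lfunE, comp_lfunE) !(linfunE (@mact_linl k A _ _)).
  by move/eqP; rewrite subr_eq0 => /eqP.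
move=> ef; apply/eqP/lfunP => a; rewrite (linfunE (lin2 _)) zero_lfunE.
apply/lfunP => x; rewrite !(add_lfunE, opp_lfunE, comp_lfunE, zero_lfunE).
by rewrite !(linfunE (@mact_linl k A _ _)) ef subrr.
Qed.

Definition homM M N : vectType k := subvs_of (equiv_space M N).

Definition mfun M N (f : homM M N) : 'Hom(M, N) := vsval f.

Definition mkhomM M N (f : 'Hom(M, N)) (ef : equivariant f) : homM M N :=
  Subvs ((equivP f).2 ef).

Lemma mfunP M N (f : homM M N) : equivariant (mfun f).
Proof. exact/equivP/subvsP. Qed.

Lemma mfun_lin M N : linear (@mfun M N).
Proof. by []. Qed.

Lemma homMP M N (f g : homM M N) : mfun f =1 mfun g -> f = g.
Proof. by move=> fg; apply/subvs_inj/lfunP. Qed.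

Lemma equivariant_comp L M N (g : homM M N) (f : homM L M) :
  equivariant (mfun g \o mfun f)%VF.
Proof. by move=> x a; rewrite !comp_lfunE !mfunP. Qed.

Lemma equivariant_id M : equivariant (\1%VF : 'Hom(M, M)).
Proof. by move=> x a; rewrite !id_lfunE. Qed.

Definition idM M : homM M M := mkhomM (@equivariant_id M).
Definition compM L M N (g : homM M N) (f : homM L M) : homM L N :=
  mkhomM (equivariant_comp g f).

Lemma compME L M N (g : homM M N) (f : homM L M) x :
  mfun (compM g f) x = mfun g (mfun f x).
Proof. exact: comp_lfunE. Qed.

Lemma idME M x : mfun (idM M) x = x.
Proof. exact: id_lfunE. Qed.

Lemma mfunPE M N c (f g : homM M N) x :
  mfun (c *: f + g) x = c *: mfun f x + mfun g x.
Proof. by rewrite mfun_lin add_lfunE scale_lfunE. Qed.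

Lemma mfunDE M N (f g : homM M N) x : mfun (f + g) x = mfun f x + mfun g x.
Proof. by rewrite -[f]scale1r mfunPE !scale1r. Qed.

Lemma mfun0E M N x : mfun (0 : homM M N) x = 0.
Proof. exact: zero_lfunE. Qed.

Lemma compM_linl L M N (f : homM L M) : linear (fun g : homM M N => compM g f).
Proof. by move=> c g h; apply: homMP => x; rewrite !(mfunPE, compME). Qed.

Lemma compM_linr L M N (g : homM M N) : linear (fun f : homM L M => compM g f).
Proof.
by move=> c f h; apply: homMP => x; rewrite !(mfunPE, compME) linearP.
Qed.

Definition zeroM : rmod A.
Proof.
refine (@RMod k A 'rV[k]_0 (fun x _ => x) _ _ _ _) => //.
- by move=> x c a b; rewrite !thinmx0.
Defined.

Definition dsumM M N : rmod A.
Proof.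
refine (@RMod k A (M * N)%type (fun x a => (mact x.1 a, mact x.2 a)) _ _ _ _).
- by move=> x a b; rewrite !mactA.
- by case=> x y; rewrite !mact1.
- by move=> a c x y; congr pair; rewrite /= mact_linl.
- by move=> x c a b; congr pair; rewrite /= mact_linr.
Defined.

Lemma inlM_lin M N : linear (fun x : M => (x, 0) : dsumM M N).
Proof. by move=> c x y; congr pair; rewrite /= scaler0 addr0. Qed.
Lemma inrM_lin M N : linear (fun y : N => (0, y) : dsumM M N).
Proof. by move=> c x y; congr pair; rewrite /= scaler0 addr0. Qed.
Lemma prlM_lin M N : linear (fun z : dsumM M N => z.1 : M).
Proof. by []. Qed.
Lemma prrM_lin M N : linear (fun z : dsumM M N => z.2 : N).
Proof. by []. Qed.

Lemma mact0l M (a : A) : mact (0 : M) a = 0.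
Proof. by have := mact_linl a (-1) (0 : M) 0; rewrite scaler0 addr0 scaleN1r addNr. Qed.

Lemma inlM_equiv M N :
  equivariant (linfun (fun x : M => (x, 0) : dsumM M N) : 'Hom(M, dsumM M N)).
Proof. by move=> x a; rewrite !(linfunE (@inlM_lin M N)) /= mact0l. Qed.
Lemma inrM_equiv M N :
  equivariant (linfun (fun y : N => (0, y) : dsumM M N) : 'Hom(N, dsumM M N)).
Proof. by move=> x a; rewrite !(linfunE (@inrM_lin M N)) /= mact0l. Qed.
Lemma prlM_equiv M N :
  equivariant (linfun (fun z : dsumM M N => z.1 : M) : 'Hom(dsumM M N, M)).
Proof. by move=> x a; rewrite !(linfunE (@prlM_lin M N)). Qed.
Lemma prrM_equiv M N :
  equivariant (linfun (fun z : dsumM M N => z.2 : N) : 'Hom(dsumM M N, N)).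
Proof. by move=> x a; rewrite !(linfunE (@prrM_lin M N)). Qed.

Definition inlM M N : homM M (dsumM M N) := mkhomM (@inlM_equiv M N).
Definition inrM M N : homM N (dsumM M N) := mkhomM (@inrM_equiv M N).
Definition prlM M N : homM (dsumM M N) M := mkhomM (@prlM_equiv M N).
Definition prrM M N : homM (dsumM M N) N := mkhomM (@prrM_equiv M N).

Lemma inlME M N x : mfun (inlM M N) x = (x, 0).
Proof. exact: (linfunE (@inlM_lin M N)). Qed.
Lemma inrME M N x : mfun (inrM M N) x = (0, x).
Proof. exact: (linfunE (@inrM_lin M N)). Qed.
Lemma prlME M N x : mfun (prlM M N) x = x.1.
Proof. exact: (linfunE (@prlM_lin M N)). Qed.
Lemma prrME M N x : mfun (prrM M N) x = x.2.
Proof. exact: (linfunE (@prrM_lin M N)). Qed.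

(* The category mod A. *)
Definition modcat : addcat k.
Proof.
refine (@AddCat k (rmod A) homM idM compM _ _ _ compM_linl compM_linr
          zeroM _ dsumM inlM inrM prlM prrM _ _ _).
- by move=> L M N P h g f; apply: homMP => x; rewrite !compME.
- by move=> M N f; apply: homMP => x; rewrite compME idME.
- by move=> M N f; apply: homMP => x; rewrite compME idME.
- by apply: homMP => x; rewrite idME mfun0E; exact: thinmx0.
- by move=> M N; apply: homMP => x; rewrite compME inlME prlME idME.
- by move=> M N; apply: homMP => x; rewrite compME inrME prrME idME.
- move=> M N; apply: homMP => -[x y].
  rewrite mfunDE !compME prlME prrME inlME inrME idME /=.
  by congr pair; rewrite /= ?addr0 ?add0r.
Defined.

Definition surjM M N (f : homM M N) : Prop := limg (mfun f) = fullv.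

Definition projective P : Prop :=
  forall M N (g : homM M N) (f : homM P N), surjM g ->
  exists h : homM P M, compM g h = f.

Definition submod_stable M (U : {vspace M}) : Prop :=
  forall x (a : A), x \in U -> mact x a \in U.

Definition superfluous M (U : {vspace M}) : Prop :=
  forall V : {vspace M}, submod_stable V -> (V + U)%VS = fullv -> V = fullv.

(* An augmented minimal projective resolution ... -> P_1 -> P_0 -> M -> 0: each
   P_i is a projective cover of its image in the next term, i.e. the kernel of
   the map leaving P_i is superfluous. *)
Record min_proj_resolution M := MinProjResolution {
  rterm : nat -> rmod A;
  rdiff : forall i, homM (rterm i.+1) (rterm i);
  raug : homM (rterm 0) M;
  rterm_proj : forall i, projective (rterm i);
  raug_surj : surjM raug;
  raug_exact : limg (mfun (rdiff 0)) = lker (mfun raug);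
  rdiff_exact : forall i,
    limg (mfun (rdiff i.+1)) = lker (mfun (rdiff i));
  raug_min : superfluous (lker (mfun raug));
  rdiff_min : forall i, superfluous (lker (mfun (rdiff i)))
}.

Definition regM : rmod A :=
  @RMod k A A (@amul k A) (fun x a b => amulA x a b) (@amul1r k A)
    (@amul_linl k A) (@amul_linr k A).

Lemma lactM_equiv P (a : A) (f : homM P regM) :
  equivariant (linfun (@amul k A a : regM -> regM) \o mfun f)%VF.
Proof.
move=> x b; rewrite !comp_lfunE mfunP.
by rewrite !(linfunE (@amul_linr k A a : linear (_ : regM -> regM))) /= amulA.
Qed.

(* The left A-module structure of Hom_A (P, A). *)
Definition lactM P (a : A) (f : homM P regM) : homM P regM :=
  mkhomM (lactM_equiv a f).

Lemma lactME P (a : A) (f : homM P regM) x :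
  mfun (lactM a f) x = amul a (mfun f x).
Proof.
rewrite comp_lfunE.
exact: (linfunE (@amul_linr k A a : linear (_ : regM -> regM))).
Qed.

Lemma lactM_linr P (a : A) : linear (@lactM P a).
Proof.
by move=> c f g; apply: homMP => x; rewrite !(mfunPE, lactME) amul_linr.
Qed.

Lemma lactM_linl P (f : homM P regM) : linear ((@lactM P)^~ f).
Proof.
by move=> c a b; apply: homMP => x; rewrite !(mfunPE, lactME) amul_linl.
Qed.

Lemma nak_lin P (a : A) (psi : 'Hom(homM P regM, k^o)) :
  linear (fun f : homM P regM => psi (lactM a f)).
Proof. by move=> c f g; rewrite lactM_linr linearP. Qed.

(* The Nakayama functor Hom_k (Hom_A (-, A), k). *)
Definition nakayama P : rmod A.
Proof.
refine (@RMod k A 'Hom(homM P regM, k^o)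
  (fun psi a => linfun (fun f : homM P regM => psi (lactM a f))) _ _ _ _).
- move=> psi a b; apply/lfunP => f; rewrite !(linfunE (@nak_lin _ _ _)).
  by congr (psi _); apply: homMP => x; rewrite !lactME amulA.
- move=> psi; apply/lfunP => f; rewrite (linfunE (@nak_lin _ _ _)).
  by congr (psi _); apply: homMP => x; rewrite !lactME amul1l.
- move=> a c psi chi; apply/lfunP => f.
  by rewrite !(add_lfunE, scale_lfunE) !(linfunE (@nak_lin _ _ _))
             !(add_lfunE, scale_lfunE).
- move=> psi c a b; apply/lfunP => f.
  rewrite !(add_lfunE, scale_lfunE) !(linfunE (@nak_lin _ _ _)).
  by rewrite lactM_linl linearP.
Defined.

Lemma nakmap_lin1 P Q (h : homM P Q) (psi : 'Hom(homM P regM, k^o)) :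
  linear (fun f : homM Q regM => psi (compM f h)).
Proof. by move=> c f g; rewrite compM_linl linearP. Qed.

Lemma nakmap_lin2 P Q (h : homM P Q) :
  linear (fun psi : nakayama P =>
    linfun (fun f : homM Q regM => (psi : 'Hom(_, _)) (compM f h)) : nakayama Q).
Proof.
move=> c psi chi; apply/lfunP => f.
by rewrite !(add_lfunE, scale_lfunE) !(linfunE (nakmap_lin1 _ _))
           !(add_lfunE, scale_lfunE).
Qed.

Lemma nakmap_equiv P Q (h : homM P Q) :
  equivariant (linfun (fun psi : nakayama P =>
    linfun (fun f : homM Q regM => (psi : 'Hom(_, _)) (compM f h))
      : nakayama Q) : 'Hom(nakayama P, nakayama Q)).
Proof.
move=> psi a; rewrite !(linfunE (nakmap_lin2 h)); apply/lfunP => f /=.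
rewrite (linfunE (nakmap_lin1 _ _)) !(linfunE (@nak_lin _ _ _)).
rewrite (linfunE (nakmap_lin1 _ _)).
by congr (psi _); apply: homMP => x; rewrite !(lactME, compME).
Qed.

Definition nakmap P Q (h : homM P Q) : homM (nakayama P) (nakayama Q) :=
  mkhomM (nakmap_equiv h).

Definition is_kernel K M N (i : homM K M) (f : homM M N) : Prop :=
  injective (mfun i) /\ limg (mfun i) = lker (mfun f).

(* K is the d-Auslander--Reiten translate of M, which is defined up to
   isomorphism: K is a kernel of nu P_d -> nu P_{d-1}.  Meant for 0 < d, where
   rdiff R d.-1 is the map P_d -> P_{d-1}. *)
Definition is_tau (d : nat) M K : Prop :=
  exists (R : min_proj_resolution M) (i : homM K (nakayama (rterm R d.-1.+1))),
    is_kernel i (nakmap (rdiff R d.-1)).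

Definition Hom_zero M N : Prop := forall f : homM M N, f = 0.

Definition Hom_tau_zero (d : nat) M N : Prop :=
  exists K, is_tau d N K /\ Hom_zero M K.

Definition addM M N : Prop := @in_add k modcat M N.

Definition maximal_tau_rigid_pair (d : nat) (D : rmod A -> Prop)
    (p : rmod A * rmod A) : Prop :=
  let: (M, P) := p in
  [/\ D M, projective P,
      forall N, D N ->
        (addM M N <->
         [/\ Hom_tau_zero d M N, Hom_tau_zero d N M & Hom_zero P N])
    & forall Q, projective Q -> (addM P Q <-> Hom_zero Q M)].

Definition isoM M N : Prop := @iso k modcat M N.

Definition iso_pair (p q : rmod A * rmod A) : Prop :=
  isoM p.1 q.1 /\ isoM p.2 q.2.

End Modules.

(* T(T, X) as a right module over the endomorphism algebra of T. *)
Definition homT (k : fieldType) (C : addcat k) (T X : C) : rmod (end_alg T) :=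
  @RMod k (end_alg T) (hom T X) (fun x a => x \oc a)
    (fun x a b => compmA x a b) (@compm1 k C T X)
    (@compm_linl k C T T X) (@compm_linr k C T T X).

Definition homT_image (k : fieldType) (C : addcat k) (T : C)
    (M : rmod (end_alg T)) : Prop :=
  exists X : C, isoM (homT T X) M.

(* The type of R-equivalence classes of the elements satisfying P. *)
Definition classes_of (O : Type) (R : O -> O -> Prop) (P : O -> Prop) : Type :=
  {K : O -> Prop | exists2 x, P x & K = R x}.

(* Main.v *)
From mathcomp Require Import all_boot all_algebra.
Require Import Defs.
From Stdlib Require Import Classical ClassicalEpsilon FunctionalExtensionality
  PropExtensionality ProofIrrelevance.

(** Write H = T(T, -) and S for the d-suspension.  Every object splits as
    X = X' (+) S P with P in add T and X' without nonzero summands in add (S T),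
    and X is sent to the pair (H X', H P).  Since H is full with kernel the maps
    factoring through add (S T), and such endomorphisms of X' are in the radical,
    this is a bijection on isomorphism classes between objects and pairs.

    The (d+2)-angle T_d -> ... -> T_0 -> Y -> S T_d becomes a projective
    resolution of H Y up to degree d.  By duality, Hom (M, tau_d N) = 0 means that
    every map P_d -> M factors through P_{d-1}, for P the minimal resolution of N;
    when Y has no summand in add (S T), P may be replaced by H T_*, so that
    Hom (H X, tau_d (H Y)) = 0 if and only if no nonzero map Y -> S X factors
    through add (S T).  By the Calabi-Yau duality, Ext^d (X, Y) = 0 if and only if
    this holds for (X, Y) and for (Y, X).

    As indecomposables are rigid, X is maximal d-rigid if and only if add X is
    the class of all Y with Ext^d (X, Y) = 0, and this condition translates
    component by component into the two conditions on the pair. *)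

Set Implicit Arguments.
Unset Strict Implicit.
Unset Printing Implicit Defensive.

Import GRing.Theory.
Local Open Scope ring_scope.

(** * Additive categories *)

Section Additive.
Variables (k : fieldType) (C : addcat k).
Implicit Types X Y Z W : C.

(** Decompositions are controlled by Fitting's lemma and induction on the dimension of endomorphism
    spaces. Having no summand in [add (S T)] is expressed as invertibility of every [1 + b a]
    passing through that class, the form in which it gets used. The obstacle is that tau_d is
    defined by minimal resolutions, while the one supplied by cluster tilting need not be minimal.
    Two truncated resolutions of one module may differ at the left end by a summand killed by the
    differential. Extendability of maps transfers as soon as every endomorphism [t] of the left term
    killed by the differential has [1 - t] invertible. For the Ext statement, Calabi-Yau duality
    pairs the composite of [f : X -> S Y] and [S Y -> S S T_d] with maps [Y -> S T_d -> S X]. Once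
    these vanish, rigidity of [T] makes [f] itself factor through [add (S T)]. *)

Lemma compmDl X Y Z (g g' : hom Y Z) (f : hom X Y) :
  (g + g') \oc f = g \oc f + g' \oc f.
Proof. by have := compm_linl f 1 g g'; rewrite !scale1r. Qed.

Lemma compmDr X Y Z (g : hom Y Z) (f f' : hom X Y) :
  g \oc (f + f') = g \oc f + g \oc f'.
Proof. by have := compm_linr g 1 f f'; rewrite !scale1r. Qed.

Lemma comp0m X Y Z (f : hom X Y) : (0 : hom Y Z) \oc f = 0.
Proof. by apply: (@addrI _ (0 \oc f)); rewrite -compmDl !addr0. Qed.

Lemma compm0 X Y Z (g : hom Y Z) : g \oc (0 : hom X Y) = 0.
Proof. by apply: (@addrI _ (g \oc 0)); rewrite -compmDr !addr0. Qed.

Lemma compmZl X Y Z c (g : hom Y Z) (f : hom X Y) :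
  (c *: g) \oc f = c *: (g \oc f).
Proof. by have := compm_linl f c g 0; rewrite comp0m !addr0. Qed.

Lemma compmZr X Y Z c (g : hom Y Z) (f : hom X Y) :
  g \oc (c *: f) = c *: (g \oc f).
Proof. by have := compm_linr g c f 0; rewrite compm0 !addr0. Qed.

Lemma compmNl X Y Z (g : hom Y Z) (f : hom X Y) : (- g) \oc f = - (g \oc f).
Proof. by rewrite -scaleN1r compmZl scaleN1r. Qed.

Lemma compmNr X Y Z (g : hom Y Z) (f : hom X Y) : g \oc (- f) = - (g \oc f).
Proof. by rewrite -scaleN1r compmZr scaleN1r. Qed.

Lemma compmBl X Y Z (g g' : hom Y Z) (f : hom X Y) :
  (g - g') \oc f = g \oc f - g' \oc f.
Proof. by rewrite compmDl compmNl. Qed.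

Lemma compmBr X Y Z (g : hom Y Z) (f f' : hom X Y) :
  g \oc (f - f') = g \oc f - g \oc f'.
Proof. by rewrite compmDr compmNr. Qed.

(** Forced by the biproduct axioms: composing [bip_split] with [prl] leaves [prl inr prr = 0], and
    [prr] is a split epimorphism. *)
Lemma prl_inr X Y : prl X Y \oc inr_ X Y = 0.
Proof.
have e : prl X Y \oc inr_ X Y \oc prr X Y = 0.
  have := congr1 (fun f => prl X Y \oc f) (bip_split X Y).
  rewrite compmDr !compmA prl_inl comp1m compm1 => e.
  by apply: (@addrI _ (prl X Y)); rewrite e addr0.
by rewrite -[inr_ X Y]compm1 -(prr_inr X Y) !compmA e comp0m.
Qed.

Lemma prr_inl X Y : prr X Y \oc inl_ X Y = 0.
Proof.
have e : prr X Y \oc inl_ X Y \oc prl X Y = 0.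
  have := congr1 (fun f => prr X Y \oc f) (bip_split X Y).
  rewrite compmDr !compmA prr_inr comp1m compm1 => e.
  by apply: (@addIr _ (prr X Y)); rewrite e add0r.
by rewrite -[inl_ X Y]compm1 -(prl_inl X Y) !compmA e comp0m.
Qed.

Lemma hom_from_zob X (f : hom zob X) : f = 0.
Proof. by rewrite -[f]compm1 zobP compm0. Qed.

Lemma hom_to_zob X (f : hom X zob) : f = 0.
Proof. by rewrite -[f]comp1m zobP comp0m. Qed.

Lemma zero_objP X : is_zero_obj X <-> idm X = 0.
Proof.
split=> [[f [g [gf _]]]|e]; first by rewrite -gf (hom_from_zob g) comp0m.
exists 0, 0; split; first by rewrite comp0m e.
by rewrite comp0m zobP.
Qed.

Lemma is_iso_id X : is_iso (idm X).
Proof. by exists (idm X); rewrite comp1m. Qed.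

Lemma is_iso_comp X Y Z (g : hom Y Z) (f : hom X Y) :
  is_iso g -> is_iso f -> is_iso (g \oc f).
Proof.
move=> [g' [gg1 gg2]] [f' [ff1 ff2]]; exists (f' \oc g'); split.
  by rewrite -compmA (compmA g') gg1 comp1m.
by rewrite -compmA (compmA f) ff2 comp1m.
Qed.

Lemma is_iso_lr X Y (f : hom X Y) (g h : hom Y X) :
  g \oc f = idm X -> f \oc h = idm Y -> is_iso f.
Proof.
move=> gf fh; exists g; split=> //.
by rewrite -[g]compm1 -fh (compmA g) gf comp1m.
Qed.

Lemma is_iso_cross X Y (f : hom X Y) (g : hom Y X) :
  is_iso (g \oc f) -> is_iso (f \oc g) -> is_iso f.
Proof.
move=> [a [a1 _]] [b [_ b2]]; apply: (@is_iso_lr _ _ _ (a \oc g) (g \oc b)).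
  by rewrite -compmA.
by rewrite compmA.
Qed.

Lemma iso_refl X : iso X X.
Proof. by exists (idm X); apply: is_iso_id. Qed.

Lemma iso_sym X Y : iso X Y -> iso Y X.
Proof. by move=> [f [g [gf fg]]]; exists g, f. Qed.

Lemma iso_trans Y X Z : iso X Y -> iso Y Z -> iso X Z.
Proof. by move=> [f fi] [g gi]; exists (g \oc f); apply: is_iso_comp. Qed.

(** A direct summand without a chosen complement: transitive and preserved by functors with no
    further work. [retract_complement] supplies the complement when idempotents split. *)
Definition retract Y X := exists (i : hom Y X) (p : hom X Y), p \oc i = idm Y.

Lemma iso_retract X Y : iso X Y -> retract X Y.
Proof. by move=> [f [g [gf _]]]; exists f, g. Qed.

Lemma retract_refl X : retract X X.
Proof. exact/iso_retract/iso_refl. Qed.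

Lemma retract_trans Y X Z : retract X Y -> retract Y Z -> retract X Z.
Proof.
move=> [i [p pi]] [j [q qj]]; exists (j \oc i), (p \oc q).
by rewrite -compmA (compmA q) qj comp1m.
Qed.

Lemma retract_bip_l X Y : retract X (X \(+) Y).
Proof. by exists (inl_ X Y), (prl X Y); rewrite prl_inl. Qed.

Lemma retract_bip_r X Y : retract Y (X \(+) Y).
Proof. by exists (inr_ X Y), (prr X Y); rewrite prr_inr. Qed.

Lemma retract_zob X : retract zob X.
Proof. by exists 0, 0; rewrite comp0m zobP. Qed.

Lemma retract_split X Y Z (i : hom X Z) (p : hom Z X) (j : hom Y Z) (q : hom Z Y) :
  i \oc p + j \oc q = idm Z -> retract Z (X \(+) Y).
Proof.
move=> e; exists (inl_ X Y \oc p + inr_ X Y \oc q), (i \oc prl X Y + j \oc prr X Y).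
rewrite compmDl !compmDr -!compmA !(compmA (prl X Y)) !(compmA (prr X Y)).
by rewrite prl_inl prl_inr prr_inl prr_inr !comp1m !comp0m !compm0 addr0 add0r.
Qed.

Lemma retract_bip X Y X' Y' :
  retract X X' -> retract Y Y' -> retract (X \(+) Y) (X' \(+) Y').
Proof.
move=> [i [p pi]] [j [q qj]].
apply: (@retract_split _ _ _ (inl_ X Y \oc p) (i \oc prl X Y)
                             (inr_ X Y \oc q) (j \oc prr X Y)).
by rewrite -!compmA (compmA p) (compmA q) pi qj !comp1m bip_split.
Qed.

(** The orthogonality [p j = 0] is automatic: inserting [i p + j q = 1] between [p] and [j] gives
    [p j = p j + p j]. The same holds for [q i]. *)
Lemma iso_split X Y Z (i : hom X Z) (p : hom Z X) (j : hom Y Z) (q : hom Z Y) :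
  p \oc i = idm X -> q \oc j = idm Y -> i \oc p + j \oc q = idm Z ->
  iso (X \(+) Y) Z.
Proof.
move=> pi qj e.
have pj : p \oc j = 0.
  have : p \oc (i \oc p + j \oc q) \oc j = p \oc j by rewrite e compm1.
  rewrite compmDr compmDl !compmA pi comp1m -(compmA _ q) qj compm1 => h.
  by apply: (@addrI _ (p \oc j)); rewrite addr0.
have qi : q \oc i = 0.
  have : q \oc (i \oc p + j \oc q) \oc i = q \oc i by rewrite e compm1.
  rewrite compmDr compmDl !compmA qj comp1m -(compmA _ p) pi compm1 => h.
  by apply: (@addrI _ (q \oc i)); rewrite addr0.
exists (i \oc prl X Y + j \oc prr X Y), (inl_ X Y \oc p + inr_ X Y \oc q); split.
  rewrite compmDl !compmDr -!compmA !(compmA p) !(compmA q) pi pj qi qj.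
  by rewrite !comp0m !compm0 !comp1m addr0 add0r bip_split.
rewrite compmDl !compmDr -!compmA !(compmA (prl X Y)) !(compmA (prr X Y)).
by rewrite prl_inl prl_inr prr_inl prr_inr !comp1m !comp0m !compm0 addr0 add0r.
Qed.

Lemma iso_bip X Y X' Y' : iso X X' -> iso Y Y' -> iso (X \(+) Y) (X' \(+) Y').
Proof.
move=> [f [f' [f1 f2]]] [g [g' [g1 g2]]].
apply: (@iso_split _ _ _ (inl_ X' Y' \oc f) (f' \oc prl X' Y')
                         (inr_ X' Y' \oc g) (g' \oc prr X' Y')).
- by rewrite -compmA (compmA _ _ f) prl_inl comp1m.
- by rewrite -compmA (compmA _ _ g) prr_inr comp1m.
- by rewrite -!compmA (compmA f) (compmA g) f2 g2 !comp1m bip_split.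
Qed.

Lemma iso_bip0 X Y : is_zero_obj Y -> iso X (X \(+) Y).
Proof.
move=> /zero_objP Y0; exists (inl_ X Y), (prl X Y); split; first exact: prl_inl.
by rewrite -bip_split -[prr X Y]comp1m Y0 comp0m compm0 addr0.
Qed.

Lemma iso_bipA X Y Z : iso (X \(+) (Y \(+) Z)) ((X \(+) Y) \(+) Z).
Proof.
set U := X \(+) Y.
pose j := mat (inr_ X Y) 0 0 (idm Z) : hom (Y \(+) Z) (U \(+) Z).
pose q := mat (prr X Y) 0 0 (idm Z) : hom (U \(+) Z) (Y \(+) Z).
apply: (@iso_split _ _ _ (inl_ U Z \oc inl_ X Y) (prl X Y \oc prl U Z) j q).
- by rewrite -compmA (compmA (prl U Z)) prl_inl comp1m prl_inl.
- rewrite /j /q /mat !comp0m !comp1m addr0 !add0r compmDl !compmDr -!compmA.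
  rewrite !(compmA (prl U Z)) !(compmA (prr U Z)) prl_inl prl_inr prr_inl prr_inr.
  rewrite !comp1m !comp0m !compm0 !addr0 !add0r !(compmA (prr X Y)) prr_inr.
  by rewrite comp1m bip_split.
- rewrite /j /q /mat !comp0m !comp1m addr0 !add0r compmDl !compmDr -!compmA.
  rewrite !(compmA (prl Y Z)) !(compmA (prr Y Z)) prl_inl prl_inr prr_inl prr_inr.
  rewrite !comp1m !comp0m !compm0 !addr0 !add0r addrA.
  rewrite -compmDr (compmA (inl_ X Y)) (compmA (inr_ X Y)) -compmDl.
  by rewrite bip_split comp1m bip_split.
Qed.

(* Jacobson's trick. *)
Lemma is_iso_1D_swap X Y (a : hom X Y) (b : hom Y X) :
  is_iso (idm X + b \oc a) -> is_iso (idm Y + a \oc b).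
Proof.
move=> [u [u1 u2]]; exists (idm Y - a \oc u \oc b); split.
  rewrite compmBl comp1m compmDr compm1.
  rewrite [a \oc b]lock -!compmA -lock -addrA -[a \oc b in X in X - _]compm1.
  have -> : a \oc (u \oc b) + a \oc (u \oc (b \oc (a \oc b))) = a \oc b.
    rewrite -!compmDr -[X in u \oc (X + _)]comp1m (compmA b) -compmDl (compmA u) u1.
    by rewrite comp1m.
  by rewrite compm1 subrr addr0.
have e : a \oc u \oc b + a \oc b \oc (a \oc u \oc b) = a \oc b.
  rewrite -!compmA -compmDr; congr (a \oc _).
  by rewrite !compmA -compmDl -[X in (X + _) \oc _]comp1m -compmDl u2 comp1m.
by rewrite compmDl comp1m compmBr compm1 -[X in _ + (X - _)]e addrK subrK.
Qed.

Definition epow X (e : hom X X) n : hom X X := iter n (compm e) (idm X).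

Lemma epowS X (e : hom X X) n : epow e n.+1 = e \oc epow e n.
Proof. by []. Qed.

Lemma epowD X (e : hom X X) m n : epow e (m + n) = epow e m \oc epow e n.
Proof.
elim: m => [|m IH]; first by rewrite [epow e 0]/epow /= comp1m.
by rewrite addSn !epowS IH compmA.
Qed.

End Additive.

(** * Fitting's lemma, additive closures and splitting off summands *)

Section Fitting.
Variables (k : fieldType) (C : addcat k).
Implicit Types X Y Z W : C.

Definition lcomp X Y Z (g : hom Y Z) : 'Hom(hom X Y, hom X Z) :=
  linfun (fun f => g \oc f).

Lemma lcompE X Y Z (g : hom Y Z) (f : hom X Y) : lcomp X g f = g \oc f.
Proof. exact: (linfunE (compm_linr g)). Qed.

Definition rcomp X Y Z (f : hom X Y) : 'Hom(hom Y Z, hom X Z) :=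
  linfun (fun g => g \oc f).

Lemma rcompE X Y Z (f : hom X Y) (g : hom Y Z) : rcomp Z f g = g \oc f.
Proof. exact: (linfunE (compm_linl f)). Qed.

Lemma ex_minimizer (A : Type) (a0 : A) (f : A -> nat) :
  exists a, forall b, (f a <= f b)%N.
Proof.
have [n] := ubnP (f a0); elim: n a0 => // n IH a0 fa0.
have [//|h] := classic (exists b, (f b < f a0)%N); last first.
  by exists a0 => b; rewrite leqNgt; apply/negP => fb; apply: h; exists b.
by move=> [b fb]; apply: (IH b); apply: leq_trans fb _.
Qed.

(* n is chosen so that the image of e^n has minimal dimension. *)
Lemma fitting X (e : hom X X) :
  exists (n : nat) (c : hom X X),
    let x := epow e n.+1 \oc c in
    x \oc x = x /\ epow e n.+1 \oc x = epow e n.+1.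
Proof.
pose L n := lcomp X (epow e n).
have [n nmin] := ex_minimizer 0%N (fun n => \dim (limg (L n.+1))).
have [p pE] : {p | p = epow e n.+1} by exists (epow e n.+1).
(* [m.+1] is twice [n.+1], so [L m.+1] is composition with [p p]. By minimality it has the same
   image as [L n.+1], hence the same kernel by rank-nullity. *)
set m := (n.+1 + n)%N.
have Ln f : L n.+1 f = p \oc f by rewrite lcompE pE.
have Lm f : L m.+1 f = p \oc (p \oc f).
  by rewrite lcompE /m -addnS epowD -compmA pE.
have simg : limg (L m.+1) = limg (L n.+1).
  apply/eqP; rewrite eqEdim nmin andbT; apply/subvP => _ /memv_imgP[f _ ->].
  by rewrite Lm -Ln memv_img ?memvf.
have sker : lker (L n.+1) = lker (L m.+1).
  apply/eqP; rewrite eqEdim; apply/andP; split.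
    by apply/subvP => f; rewrite !memv_ker Lm Ln => /eqP ->; rewrite compm0.
  have := limg_ker_dim (L m.+1) fullv; rewrite -(limg_ker_dim (L n.+1) fullv).
  by rewrite !capfv simg => /addIn ->.
have : p \in limg (L m.+1).
  by rewrite simg -[p]compm1 -Ln memv_img ?memvf.
move=> /memv_imgP[c _]; rewrite Lm => pc; exists n, c; cbv zeta; rewrite -pE.
have ppc : p \oc p \oc c = p by rewrite -compmA.
split; last by rewrite -pc.
(* Since [p p c = p], the element [c (1 - p c)] is killed by [p p], hence already by [p]: this is
   the idempotence of [p c]. *)
have : c \oc (idm X - p \oc c) \in lker (L n.+1).
  rewrite sker memv_ker Lm compmBr compm1 !compmBr !compmA.
  by rewrite !ppc subrr.
rewrite memv_ker Ln compmBr compm1 compmBr subr_eq0 => /eqP h.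
by rewrite -compmA -h.
Qed.

(** The right inverse makes precomposition with [u] injective on the finite-dimensional space of
    endomorphisms, hence surjective; a preimage of the identity is a left inverse. *)
Lemma right_inverse_iso X (u c : hom X X) : u \oc c = idm X -> is_iso u.
Proof.
move=> uc; have inj : (lker (rcomp X u) == 0)%VS.
  rewrite -subv0; apply/subvP => g; rewrite memv_ker rcompE memv0 => /eqP gu.
  by rewrite -[g]compm1 -uc compmA gu comp0m.
apply: (is_iso_lr (g := (rcomp X u)^-1%VF (idm X)) _ uc).
by rewrite -rcompE lker0_lfunVK.
Qed.

(* If 1 + ba is not invertible, Fitting's lemma for 1 + ba provides a nonzero
   idempotent y with (1 + ba)^n y = 0, which therefore factors through b. *)
Lemma non_iso_1D X Y (a : hom X Y) (b : hom Y X) :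
  ~ is_iso (idm X + b \oc a) ->
  exists (w : hom X Y), let y := b \oc w in y \oc y = y /\ y <> 0.
Proof.
set u := idm X + _ => nu.
have up n : exists w, epow u n = idm X + b \oc w.
  elim: n => [|n [w IH]]; first by exists 0; rewrite compm0 addr0.
  exists (w + a \oc epow u n).
  rewrite /epow iterS -/(epow u n) {1}/u compmDl comp1m {1}IH -addrA compmDr.
  by rewrite compmA.
have [n [c /= [xx ex]]] := fitting u; set x := _ \oc c in xx ex.
have [w ew] := up n.+1.
pose y := idm X - x.
have yy : y \oc y = y.
  by rewrite /y compmBl comp1m compmBr compm1 xx subrr subr0.
have uy : y + b \oc (w \oc y) = 0.
  rewrite compmA -[X in X + _]comp1m -compmDl -ew /y compmBr compm1 ex subrr //.
exists (- (w \oc y)) => /=; rewrite compmNr.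
have -> : - (b \oc (w \oc y)) = y by apply/eqP; rewrite eq_sym -addr_eq0 uy.
split=> // y0; apply: nu; apply: (right_inverse_iso (c := epow u n \oc c)).
by apply/esym/eqP; rewrite compmA -subr_eq0 -/(epow u n.+1) -/x -/y y0.
Qed.

Lemma in_add_refl X : in_add X X.
Proof. exists 1, zob; exact: iso_refl. Qed.

Lemma in_add_zob X : in_add X zob.
Proof. exists 0, zob; apply/iso_sym/iso_bip0; exact: iso_refl. Qed.

Lemma in_add_copies X Y : in_add X Y -> exists n, retract Y (copies X n).
Proof.
move=> [n [Z h]]; exists n.
exact: retract_trans (retract_bip_l Y Z) (iso_retract h).
Qed.

Lemma in_add_iso X Y Z : iso Y Z -> in_add X Y -> in_add X Z.
Proof.
move=> YZ [n [W h]]; exists n, W; apply: iso_trans _ h.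
exact: iso_bip (iso_sym YZ) (iso_refl W).
Qed.

(** The induction principle by which vanishing, projectivity and Yoneda arguments pass from a single
    object, usually [T], to its additive closure. *)
Lemma in_add_ind X (P : C -> Prop) :
  P zob -> P X -> (forall Y Z, P Y -> P Z -> P (Y \(+) Z)) ->
  (forall Y Z, P Y -> retract Z Y -> P Z) -> forall Y, in_add X Y -> P Y.
Proof.
move=> P0 PX PD Pr Y /in_add_copies[n]; apply: Pr; elim: n => //= n IH; exact: PD.
Qed.

Hypothesis hsplit : split_idempotents C.

Lemma retract_complement X Y : retract Y X -> exists Z, iso (Y \(+) Z) X.
Proof.
move=> [i [p pi]]; have [Z [q [j [qj jq]]]] : exists (Z : C) (q : hom X Z) (j : hom Z X),
    q \oc j = idm Z /\ j \oc q = idm X - i \oc p.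
  apply: hsplit; rewrite compmBl comp1m compmBr compm1.
  by rewrite -compmA (compmA p) pi comp1m subrr subr0.
by exists Z; apply: (iso_split pi qj); rewrite jq addrC subrK.
Qed.

Lemma in_addP X Y : in_add X Y <-> exists n, retract Y (copies X n).
Proof.
split=> [/in_add_copies //|[n /retract_complement[Z h]]].
by exists n, Z.
Qed.

Lemma retract_copiesD X m n :
  retract (copies X m \(+) copies X n) (copies X (m + n)).
Proof.
elim: m => [|m IH] /=.
  apply: iso_retract; apply: (@iso_split _ _ _ _ _ 0 0 (idm _) (idm _)).
  - by rewrite comp0m zobP.
  - by rewrite comp1m.
  - by rewrite comp0m add0r comp1m.
apply: retract_trans (iso_retract (iso_sym (iso_bipA _ _ _))) _.
exact: retract_bip (retract_refl _) IH.
Qed.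

Lemma in_add_retract X Y Z : in_add X Y -> retract Z Y -> in_add X Z.
Proof.
move=> /in_addP[n h] r; apply/in_addP; exists n; exact: retract_trans r h.
Qed.

Lemma in_add_bip X Y Z : in_add X Y -> in_add X Z -> in_add X (Y \(+) Z).
Proof.
move=> /in_addP[m hm] /in_addP[n hn]; apply/in_addP; exists (m + n)%N.
exact: retract_trans (retract_bip hm hn) (retract_copiesD X m n).
Qed.

Lemma in_add_trans X Y Z : in_add X Y -> in_add Y Z -> in_add X Z.
Proof.
move=> XY; apply: in_add_ind => // [|A B|A B].
- exact: in_add_zob.
- exact: in_add_bip.
- exact: in_add_retract.
Qed.

Lemma iso_bipE X Y Z : iso X (Y \(+) Z) ->
  exists (i : hom Y X) (p : hom X Y) (j : hom Z X) (q : hom X Z),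
    [/\ p \oc i = idm Y, q \oc j = idm Z, q \oc i = 0 /\ p \oc j = 0
      & i \oc p + j \oc q = idm X].
Proof.
move=> [f [g [gf fg]]].
exists (g \oc inl_ Y Z), (prl Y Z \oc f), (g \oc inr_ Y Z), (prr Y Z \oc f).
split.
- by rewrite -compmA (compmA f) fg comp1m prl_inl.
- by rewrite -compmA (compmA f) fg comp1m prr_inr.
- by split; rewrite -compmA (compmA f) fg comp1m ?prr_inl ?prl_inr.
- by rewrite -!compmA -compmDr !compmA -compmDl bip_split comp1m.
Qed.

(** The decreasing measure of all inductions on decompositions. The map [h |-> i h p] embeds End Y
    into End X and misses [j q]: sandwiching between [q] and [j] kills its image but sends [j q] to
    the nonzero identity of [Z]. *)
Lemma dim_end_bip X Y Z :
  iso X (Y \(+) Z) -> ~ is_zero_obj Z ->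
  (\dim (fullv : {vspace hom Y Y}) < \dim (fullv : {vspace hom X X}))%N.
Proof.
move=> /iso_bipE[i [p [j [q [pi qj [qi _] _]]]]] nZ.
pose F : 'Hom(hom Y Y, hom X X) := (lcomp X i \o rcomp Y p)%VF.
have FE h : F h = i \oc (h \oc p) by rewrite comp_lfunE lcompE rcompE.
have kF : lker F == 0%VS.
  apply/lker0P => h h'; rewrite !FE => /(congr1 (fun u => p \oc (u \oc i))).
  by rewrite -!compmA pi !compm1 !(compmA p) pi !comp1m.
rewrite -(limg_dim_eq (f := F)); last by rewrite capfv; apply/eqP.
rewrite ltn_neqAle dimvS ?subvf // andbT.
apply/negP => /eqP edim; apply: nZ; apply/zero_objP.
have : j \oc q \in limg F.
  suff -> : limg F = fullv by rewrite memvf.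
  by apply/eqP; rewrite eqEdim subvf edim /= leqnn.
move=> /memv_imgP[h _]; rewrite FE => e.
have : q \oc (j \oc q) \oc j = 0 by rewrite e (compmA q) qi !comp0m.
by rewrite -compmA -!(compmA j) qj compm1 qj.
Qed.

End Fitting.

(** * Exactness of angles *)

Section Exactness.
Variables (k : fieldType) (C : addcat k).
Implicit Types X Y Z W : C.

(** Exactness under both Hom functors: [f] is a weak kernel of [g] and [g] a weak cokernel of [f].
    Angles have no more than this. *)
Definition exact_at X Y Z (f : hom X Y) (g : hom Y Z) : Prop :=
  [/\ g \oc f = 0,
      forall W (w : hom W Y), g \oc w = 0 -> exists u, w = f \oc u
    & forall W (z : hom Y W), z \oc f = 0 -> exists u, z = u \oc g].

Lemma exact_at_scale X Y Z (f : hom X Y) (g : hom Y Z) c :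
  c != 0 -> exact_at f (c *: g) <-> exact_at f g.
Proof.
move=> c0; have e W (w : hom W Y) : (c *: g) \oc w = 0 <-> g \oc w = 0.
  rewrite compmZl; split=> [/eqP|->]; last by rewrite scaler0.
  by rewrite scaler_eq0 (negPf c0) => /eqP.
split=> -[gf cov con]; split=> [||W z zf]; try by [apply/e | move=> W w /e/cov].
  by have [u ->] := con W z zf; exists (c *: u); rewrite compmZr compmZl.
have [u ->] := con W z zf; exists (c^-1 *: u).
by rewrite compmZl compmZr scalerA mulVf // scale1r.
Qed.

(* The first j consecutive pairs of the sequence f, c are exact. *)
Fixpoint exact_upto (j : nat) m X Y Z (f : hom X Y) :
    chain m Y Z -> Prop :=
  match j, m return chain m Y Z -> Prop with
  | 0, _ => fun _ => True
  | _.+1, 0 => fun g => exact_at f g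
  | j'.+1, m'.+1 => fun c =>
      exact_at f (projT2 c).1 /\ exact_upto j' (projT2 c).1 (projT2 c).2
  end.

Definition exact_chain m X Y Z (f : hom X Y) (c : chain m Y Z) :=
  forall j, exact_upto j f c.

Lemma exact_chain0 X Y Z (f : hom X Y) (g : hom Y Z) :
  exact_chain (m := 0) f g -> exact_at f g.
Proof. by move/(_ 1). Qed.

Lemma exact_chain_link m X Y Z V (f : hom X Y) (g : hom Y Z) (c : chain m Z V) :
  exact_chain f (link g c) -> exact_at f g /\ exact_chain g c.
Proof.
by move=> h; split=> [|j]; [have [] := h 1 | have [] := h j.+1].
Qed.

Lemma exact_upto_snoc j m X Y Z V (f : hom X Y) (c : chain m Y Z) (g : hom Z V) :
  exact_upto j f (snoc c g) -> exact_upto j f c.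
Proof.
elim: m X Y Z V f c g j => [|m IH] X Y Z V f c g [|j] //=; first by case.
by move=> [fc /IH].
Qed.

Lemma exact_snoc2 m X Y Z V U (f : hom X Y) (c : chain m Y Z) (g : hom Z V)
    (h : hom V U) :
  exact_chain f (snoc (snoc c g) h) -> exact_at g h.
Proof.
elim: m X Y Z V U f c g h => [|m IH] X Y Z V U f c g h.
  by move=> /exact_chain_link[_] /exact_chain_link[_] /exact_chain0.
by move=> /exact_chain_link[_] /IH.
Qed.

Lemma ladder_snoc m X Y Z X' Y' Z' (c : chain m X Y) (c' : chain m X' Y')
    (g : hom Y Z) (g' : hom Y' Z') u (r : rungs (snoc c g) (snoc c' g')) v :
  ladder u r v -> exists w : hom Y Y', v \oc g = g' \oc w.
Proof.
elim: m X X' c c' u r => [|m IH] X X' c c' u /= r; first by case=> _ h; exists r.1.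
by case=> _ /IH.
Qed.

(** Rotating produces a tail through [S zob], a zero object that need not be the [zob] of
    [zero_chain]; the two zero tails are therefore only compared up to isomorphism. *)
Lemma ladder_zero_snoc m X X' Y Y' Z (g : hom Z Y') (u : hom X X') (v : hom Y Y') :
  is_zero_obj Z ->
  exists r : rungs (zero_chain m.+1 X Y) (snoc (zero_chain m X' Z) g),
    iso_rungs r /\ ladder u r v.
Proof.
move=> Z0; elim: m X X' u => [|m IH] X X' u.
  exists (0 : hom zob Z, tt); split=> /=.
    split=> //; exists 0; move/zero_objP: Z0 => Z0.
    by rewrite !comp0m zobP Z0.
  by split; rewrite ?comp0m ?compm0.
have [r [ir lr]] := IH zob zob (idm zob).
exists (idm zob, r); split=> /=; split=> //; first exact: is_iso_id.
by rewrite compm0 comp0m.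
Qed.

(** Isolates the last two maps before [Y] in a resolution. For [m = 0] the object before [X] is [W],
    which is why [P W] is assumed. *)
Lemma all_sources_snoc_last (P : C -> Prop) m X Y Z W (f : hom W X)
    (c : chain m X Y) (h : hom Y Z) :
  all_sources P c -> P W -> exact_chain f (snoc c h) ->
  exists X1 X0 (p : hom X1 X0) (q : hom X0 Y),
    [/\ P X1, P X0, exact_at p q & exact_at q h].
Proof.
elim: m X W f c => [|m IH] X W f c.
  move=> PX PW /exact_chain_link[fc /exact_chain0 ch].
  by exists W, X, f, c.
by case: c => V [f' c] [PX /IH h'] _ /exact_chain_link[_ /h']; apply.
Qed.
End Exactness.

Section Angles.
Variables (k : fieldType) (C : addcat k) (d : nat) (S : angulation C d.+1).
Implicit Types X Y Z W : C.
Notation angle := (angle (a := S)).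
Notation susp := (susp S).

Lemma angle_rot X Y (a : hom X Y) (c : chain d.+1 Y (susp X)) :
  angle (link a c) -> angle (snoc c ((-1) ^+ d.+3 *: suspm S a) : nseq susp d.+1 Y).
Proof. by move/(angle_rotate (a := S)). Qed.

Lemma susp_surj Y : exists X, susp X = Y.
Proof. by have [g _ gK] := susp_bij S; exists (g Y). Qed.

Lemma suspm_surj X Y (f : hom (susp X) (susp Y)) : exists g, f = suspm S g.
Proof. by have [g _ gK] := suspm_bij S X Y; exists (g f); rewrite gK. Qed.

Lemma suspm_inj X Y : injective (@suspm _ _ _ S X Y).
Proof. exact: bij_inj (suspm_bij S X Y). Qed.

Lemma suspmD X Y (f g : hom X Y) : suspm S (f + g) = suspm S f + suspm S g.
Proof. by have := suspm_lin S 1 f g; rewrite !scale1r. Qed.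

Lemma suspm0 X Y : suspm S (0 : hom X Y) = 0.
Proof. by apply: (@addrI _ (suspm S 0)); rewrite -suspmD !addr0. Qed.

Lemma suspmN X Y (f : hom X Y) : suspm S (- f) = - suspm S f.
Proof. by apply: (@addrI _ (suspm S f)); rewrite -suspmD !subrr suspm0. Qed.

Lemma suspmB X Y (f g : hom X Y) : suspm S (f - g) = suspm S f - suspm S g.
Proof. by rewrite suspmD suspmN. Qed.

Lemma suspm_eq0 X Y (f : hom X Y) : suspm S f = 0 -> f = 0.
Proof. by move=> f0; apply: suspm_inj; rewrite suspm0. Qed.

Lemma suspm_iso X Y (f : hom X Y) : is_iso (suspm S f) <-> is_iso f.
Proof.
split=> [[g [gf fg]]|[g [gf fg]]]; last first.
  by exists (suspm S g); rewrite -!suspm_comp gf fg !suspm_id.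
have [h eh] := suspm_surj g; exists h.
by split; apply: suspm_inj; rewrite suspm_comp suspm_id -eh.
Qed.

Lemma susp_iso X Y : iso X Y -> iso (susp X) (susp Y).
Proof. by move=> [f fi]; exists (suspm S f); apply/suspm_iso. Qed.

Lemma iso_susp X Y : iso (susp X) (susp Y) -> iso X Y.
Proof.
by move=> [f fi]; have [g e] := suspm_surj f; exists g; apply/suspm_iso; rewrite -e.
Qed.

Lemma susp_retract X Y : retract X Y -> retract (susp X) (susp Y).
Proof.
by move=> [i [p pi]]; exists (suspm S i), (suspm S p); rewrite -suspm_comp pi suspm_id.
Qed.

Lemma susp_zero X : is_zero_obj X -> is_zero_obj (susp X).
Proof. by move=> /zero_objP X0; apply/zero_objP; rewrite -suspm_id X0 suspm0. Qed.

Lemma susp_bip_iso X Y : iso (susp X \(+) susp Y) (susp (X \(+) Y)).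
Proof.
apply: (iso_split (i := suspm S (inl_ X Y)) (p := suspm S (prl X Y))
                  (j := suspm S (inr_ X Y)) (q := suspm S (prr X Y))).
- by rewrite -suspm_comp prl_inl suspm_id.
- by rewrite -suspm_comp prr_inr suspm_id.
- by rewrite -!suspm_comp -suspmD bip_split suspm_id.
Qed.

Lemma exact_susp X Y Z (f : hom X Y) (g : hom Y Z) :
  exact_at (suspm S f) (suspm S g) <-> exact_at f g.
Proof.
split=> -[gf cov con]; split.
- by apply: suspm_inj; rewrite suspm_comp gf suspm0.
- move=> W w gw; have [|u] := cov _ (suspm S w); first by rewrite -suspm_comp gw suspm0.
  have [v ->] := suspm_surj u; rewrite -suspm_comp => /suspm_inj ->.
  by exists v.
- move=> W w gw; have [|u] := con _ (suspm S w); first by rewrite -suspm_comp gw suspm0.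
  have [v ->] := suspm_surj u; rewrite -suspm_comp => /suspm_inj ->.
  by exists v.
- by rewrite -suspm_comp gf suspm0.
- move=> W; have [V <-] := susp_surj W; move=> w; have [v ->] := suspm_surj w.
  rewrite -suspm_comp => /suspm_eq0/cov[u ->].
  by exists (suspm S u); rewrite suspm_comp.
- move=> W; have [V <-] := susp_surj W; move=> w; have [v ->] := suspm_surj w.
  rewrite -suspm_comp => /suspm_eq0/con[u ->].
  by exists (suspm S u); rewrite suspm_comp.
Qed.

(** The trivial angle of [W] rotated backwards. It is the target against which weak cokernels are
    tested. *)
Lemma angle_trivial' W :
  angle (link (0 : hom zob W) (link (idm W) (zero_chain d W (susp zob)))
         : nseq susp d.+1 zob).
Proof.
apply/(angle_rotate (a := S)); apply: angle_iso (angle_trivial S W).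
have [r [ir lr]] := ladder_zero_snoc d ((-1) ^+ d.+3 *: suspm S (0 : hom zob W))
  (idm W) (suspm S (idm W)) (susp_zero (iso_refl zob)).
exists (idm W), (idm W, r); split; [exact: is_iso_id | split=> //; exact: is_iso_id |].
by split.
Qed.

(** Each clause is one completion of a partial morphism of angles: from the trivial angle of [X],
    between rotated angles, and into [angle_trivial']. *)
Lemma angle_exact2 X Y Z (a : hom X Y) (b : hom Y Z) (c : chain d Z (susp X)) :
  angle (link a (link b c) : nseq susp d.+1 X) -> exact_at a b.
Proof.
move=> abc; split.
- have [|r [h _]] := angle_morph (f1 := idm X) (f2 := a) (angle_trivial S X) abc.
    by [].
  by rewrite /= compm0 in h.
- move=> W w bw.
  have [|r] := angle_morph (f1 := w) (f2 := 0 : hom zob Z)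
    (angle_rot (angle_trivial S W)) (angle_rot abc); first by rewrite bw comp0m.
  move=> /ladder_snoc[u]; have [v ->] := suspm_surj u.
  (* The last square reads [S w = S a u] up to the sign of the rotation, which occurs on both sides
     and cancels. *)
  rewrite compmZl compmZr suspm_id compm1 -suspm_comp.
  move/(can_inj (signrZK _))/suspm_inj => ->; by exists v.
- move=> W z za.
  have [|r [h _]] := angle_morph (f1 := 0 : hom X zob) (f2 := z) abc (angle_trivial' W).
    by rewrite za comp0m.
  by exists r.1; rewrite h /= comp1m.
Qed.

(** Rotation preserves the length of the sequence, so the induction runs on the number [j] of exact
    pairs: the first pair is [angle_exact2], and the others are the first [j] pairs of the rotated
    angle. *)
Lemma angle_exact X Y (a : hom X Y) (c : chain d.+1 Y (susp X)) :
  angle (link a c : nseq susp d.+1 X) -> exact_chain a c.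
Proof.
move=> ac j; elim: j X Y a c ac => // j IH X Y a [Z [b c]] ac.
split; first exact: angle_exact2 ac.
exact: exact_upto_snoc (IH _ _ _ _ (angle_rot ac)).
Qed.
End Angles.

(** Membership in a subspace is tested on the dual, both for the Nakayama and for the Calabi-Yau
    duality. The functional is a coordinate nonzero at [v - projv U v], composed with the projection
    [1 - projv U]. *)
Lemma separating_functional (k : fieldType) (V : vectType k) (U : {vspace V}) (v : V) :
  v \notin U -> exists phi : 'Hom(V, k^o), phi v != 0 /\ (forall u, u \in U -> phi u = 0).
Proof.
move=> vU; pose w := v - projv U v.
have w0 : w != 0.
  by rewrite subr_eq0; apply: contraNneq vU => ->; rewrite memv_proj.
have [i wi] : exists i, coord (vbasis fullv) i w != 0.
  apply/existsP; apply: contraNT w0 => /existsPn h.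
  rewrite (coord_vbasis (memvf w)) big1 // => i _.
  by have /negPn/eqP -> := h i; rewrite scale0r.
pose c : {linear V -> k^o} := coord (vbasis fullv) i.
exists (linfun c \o (\1 - projv U))%VF; split=> [|u uU].
  by rewrite comp_lfunE lfunE add_lfunE opp_lfunE id_lfunE.
by rewrite comp_lfunE add_lfunE opp_lfunE id_lfunE projv_id // subrr linear0.
Qed.

(** * Modules *)

Section Mod.
Variables (k : fieldType) (A : fdalg k).
Implicit Types L M N P Q : rmod A.

Local Notation mod := (modcat A).
Local Notation freeM := (@copies k mod (regM A)).

Lemma mfun_eq M N (f g : homM M N) x : f = g -> mfun f x = mfun g x.
Proof. by move->. Qed.

Lemma mod_cancel M N (f : homM M N) (g : homM N M) x :
  @compm k mod M N M g f = idm (M : mod) -> mfun g (mfun f x) = x.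
Proof. by move=> /(mfun_eq x); rewrite (compME g f) (idME x). Qed.

Lemma mfunD M N (f : homM M N) x y : mfun f (x + y) = mfun f x + mfun f y.
Proof. exact: linearD. Qed.

Lemma mfun0 M N (f : homM M N) : mfun f 0 = 0.
Proof. exact: linear0. Qed.

Lemma mfun_sum M N (f : homM M N) (I : Type) (r : seq I) (F : I -> M) :
  mfun f (\sum_(i <- r) F i) = \sum_(i <- r) mfun f (F i).
Proof. exact: linear_sum. Qed.

Lemma mfun_sumE M N (I : Type) (r : seq I) (F : I -> homM M N) x :
  mfun (\sum_(i <- r) F i) x = \sum_(i <- r) mfun (F i) x.
Proof.
elim: r => [|i r IH]; first by rewrite !big_nil mfun0E.
by rewrite !big_cons mfunDE IH.
Qed.

Lemma surjMP M N (f : homM M N) :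
  surjM f <-> forall y, exists x, mfun f x = y.
Proof.
split=> [sf y|sf].
  by have /memv_imgP[x _ ->] : y \in limg (mfun f); [rewrite sf memvf | exists x].
apply/eqP; rewrite eqEsubv subvf; apply/subvP => y _.
by have [x <-] := sf y; rewrite memv_img ?memvf.
Qed.

Lemma limg_eq_lker L M N (f : homM L M) (g : homM M N) :
  limg (mfun f) = lker (mfun g) <->
  compM g f = 0 /\ (forall y, mfun g y = 0 -> exists x, mfun f x = y).
Proof.
split=> [e|[gf ex]]; last first.
  apply/eqP; rewrite eqEsubv; apply/andP; split; apply/subvP => y.
    move=> /memv_imgP[x _ ->]; rewrite memv_ker -compME gf mfun0E //.
  by rewrite memv_ker => /eqP/ex[x <-]; rewrite memv_img ?memvf.
split=> [|y gy].
  apply: homMP => x; rewrite compME mfun0E; apply/eqP.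
  by rewrite -memv_ker -e memv_img ?memvf.
have /memv_imgP[x _ ->] : y \in limg (mfun f) by rewrite e memv_ker gy.
by exists x.
Qed.

Section Submodule.
Variables (M : rmod A) (U : {vspace M}) (stU : submod_stable U).

Definition subM : rmod A.
Proof.
refine (@RMod k A (subvs_of U) (fun x a => vsproj U (mact (vsval x) a)) _ _ _ _).
- move=> x a b; congr (vsproj U _); rewrite mactA vsprojK //.
  exact/stU/subvsP.
- by move=> x; rewrite mact1 vsvalK.
- by move=> a c x y; rewrite linearP mact_linl linearP.
- by move=> x c a b; rewrite mact_linr linearP.
Defined.

Lemma vsval_equivariant : equivariant (linfun vsval : 'Hom(subM, M)).
Proof. by move=> x a; rewrite !lfunE /= vsprojK //; apply/stU/subvsP. Qed.

Definition inclM : homM subM M := mkhomM vsval_equivariant.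

Lemma inclME x : mfun inclM x = vsval x.
Proof. exact: lfunE. Qed.

Lemma inclM_inj : injective (mfun inclM).
Proof. by move=> x y; rewrite !inclME; apply: subvs_inj. Qed.

Lemma inclM_mem x : mfun inclM x \in U.
Proof. by rewrite inclME subvsP. Qed.

Lemma inclM_surj y : y \in U -> exists x, mfun inclM x = y.
Proof. by move=> yU; exists (vsproj U y); rewrite inclME vsprojK. Qed.

Lemma limg_inclM : limg (mfun inclM) = U.
Proof.
apply/eqP; rewrite eqEsubv; apply/andP; split; apply/subvP => y.
  by move=> /memv_imgP[x _ ->]; apply: inclM_mem.
by move=> /inclM_surj[x <-]; rewrite memv_img ?memvf.
Qed.
End Submodule.

Lemma inj_factor L M N (i : homM M N) (f : homM L N) :
  injective (mfun i) -> (forall x, mfun f x \in limg (mfun i)) ->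
  exists g : homM L M, compM i g = f.
Proof.
move=> inj im; pose g := ((mfun i)^-1 \o mfun f)%VF.
have ig x : mfun i (g x) = mfun f x by rewrite comp_lfunE limg_lfunVK ?im.
have eg : equivariant g by move=> x a; apply: inj; rewrite mfunP !ig mfunP.
by exists (mkhomM eg); apply: homMP => x; rewrite compME ig.
Qed.

Lemma sub_factor L M (U : {vspace M}) (stU : submod_stable U) (f : homM L M) :
  (forall x, mfun f x \in U) -> exists g : homM L (subM stU), compM (inclM stU) g = f.
Proof.
by move=> fU; apply: inj_factor; [exact: inclM_inj | move=> x; rewrite limg_inclM].
Qed.

Lemma lker_stable M N (f : homM M N) : submod_stable (lker (mfun f)).
Proof.
by move=> x a; rewrite !memv_ker mfunP => /eqP ->; rewrite mact0l.
Qed.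

Lemma limg_stable M N (f : homM M N) : submod_stable (limg (mfun f)).
Proof. by move=> _ a /memv_imgP[x _ ->]; rewrite -mfunP memv_img ?memvf. Qed.

Arguments lker_stable [M N] f.
Arguments limg_stable [M N] f.

Lemma mod_split_idempotents : split_idempotents mod.
Proof.
move=> M e ee; have ee' x : mfun (e : homM M M) (mfun (e : homM M M) x) = mfun (e : homM M M) x.
  by rewrite -compME; apply: mfun_eq.
have [p ip] := @sub_factor M M _ (limg_stable (e : homM M M)) e
  (fun x => memv_img _ (memvf x)).
exists (subM (limg_stable (e : homM M M))), p, (inclM _); split; last exact: ip.
apply: homMP => x; rewrite idME; apply: inclM_inj; rewrite compME -compME ip.
have /memv_imgP[y _ ->] := inclM_mem x; exact: ee'.
Qed.

Lemma isoM_bij M N (f : homM M N) :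
  injective (mfun f) -> surjM f -> @is_iso k mod M N f.
Proof.
move=> inj sf; have [|g fg] := @inj_factor N M N f (idM N) inj; first by move=> x; rewrite sf memvf.
exists g; split; last exact: fg.
apply: homMP => x; apply: inj.
by rewrite (compME g f) -(compME f g) fg !idME.
Qed.

Lemma surjM_iso M (f : homM M M) : surjM f -> @is_iso k mod M M f.
Proof.
move=> sf; apply: isoM_bij => //; apply/lker0P; rewrite -dimv_eq0.
by have /eqP := limg_ker_dim (mfun f) fullv; rewrite capfv sf -[X in _ == X]add0n eqn_add2r.
Qed.

Lemma genM_lin M (x : M) : linear (fun a : regM A => mact x a).
Proof. exact: mact_linr. Qed.

Lemma genM_equiv M (x : M) : equivariant (linfun (fun a : regM A => mact x a)).
Proof. by move=> a b; rewrite !(linfunE (genM_lin x)) mactA. Qed.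

Definition genM M (x : M) : homM (regM A) M := mkhomM (genM_equiv x).

Lemma genME M (x : M) a : mfun (genM x) a = mact x a.
Proof. exact: (linfunE (genM_lin x)). Qed.

Definition copairM P Q M (f : homM P M) (g : homM Q M) : homM (dsumM P Q) M :=
  compM f (prlM P Q) + compM g (prrM P Q).

Lemma copairME P Q M (f : homM P M) (g : homM Q M) z :
  mfun (copairM f g) z = mfun f z.1 + mfun g z.2.
Proof. by rewrite mfunDE !compME prlME prrME. Qed.

Lemma exists_gen_hom M (s : seq M) :
  exists (n : nat) (f : homM (freeM n) M), forall x, x \in s -> exists y, mfun f y = x.
Proof.
elim: s => [|x s [n [f IH]]]; first by exists 0, 0.
exists n.+1, (copairM (genM x) f) => y; rewrite inE => /predU1P[->|/IH[z <-]].
  exists (aone A, 0); rewrite (copairME (genM x) f) genME mact1 -[RHS]addr0.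
  congr (_ + _); exact: mfun0.
exists (0, z); rewrite (copairME (genM x) f) -[RHS]add0r.
congr (_ + _); exact: mfun0.
Qed.

Lemma exists_free_cover M : exists n (f : homM (freeM n) M), surjM f.
Proof.
have [n [f h]] := exists_gen_hom (vbasis (fullv : {vspace M})); exists n, f.
apply/eqP; rewrite eqEsubv subvf -(span_basis (vbasisP fullv)).
by apply/span_subvP => x /h[y <-]; rewrite memv_img ?memvf.
Qed.

Lemma projective_zero : projective (zeroM A).
Proof.
move=> M N g f _; exists 0; apply: homMP => x.
have -> : x = 0 by exact: thinmx0.
by transitivity (0 : N); [|symmetry]; exact: mfun0.
Qed.

Lemma projective_reg : projective (regM A).
Proof.
move=> M N g f /surjMP/(_ (mfun f (aone A)))[m gm]; exists (genM m).
apply: homMP => a; rewrite compME genME mfunP gm -mfunP.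
by congr (mfun f _); apply: amul1l.
Qed.

Lemma projective_dsum P Q : projective P -> projective Q -> projective (dsumM P Q).
Proof.
move=> pP pQ M N g f sg.
have [h1 e1] := pP M N g (compM f (inlM P Q)) sg.
have [h2 e2] := pQ M N g (compM f (inrM P Q)) sg.
exists (copairM h1 h2); apply: homMP => z.
rewrite compME copairME mfunD -!compME e1 e2 !compME inlME inrME -mfunD.
by case: z => x y; congr (mfun f _); congr pair; rewrite /= ?addr0 ?add0r.
Qed.

Lemma projective_retract P Q : projective P -> @retract k mod Q P -> projective Q.
Proof.
move=> pP [i [p pi]] M N g f sg; have [h e] := pP M N g (compM f p) sg.
exists (compM h i); apply: homMP => x.
by rewrite compME (compME h i) -(compME g h) e (compME f p) (mod_cancel _ pi).
Qed.

Lemma projective_free n : projective (freeM n).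
Proof.
elim: n => [|n IH]; first exact: projective_zero.
exact: projective_dsum projective_reg IH.
Qed.

Lemma projective_retract_free P : projective P -> exists n, @retract k mod P (freeM n).
Proof.
move=> pP; have [n [f sf]] := exists_free_cover P.
by have [h e] := pP _ _ f (idM P) sf; exists n, h, f.
Qed.

(** The data of the dual basis lemma. It turns the duality between Hom (M, nu P) and Hom (P, M) into
    manipulations of finite sums. *)
Definition is_dual_basis P (s : seq (P * homM P (regM A))) : Prop :=
  forall p, p = \sum_(t <- s) mact t.1 (mfun t.2 p : A).

Lemma dual_basis_dsum P Q s t :
  @is_dual_basis P s -> @is_dual_basis Q t ->
  @is_dual_basis (dsumM P Q)
    ([seq (mfun (inlM P Q) x.1, compM x.2 (prlM P Q)) | x <- s]
     ++ [seq (mfun (inrM P Q) x.1, compM x.2 (prrM P Q)) | x <- t]).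
Proof.
move=> hs ht z; rewrite big_cat !big_map.
transitivity (mfun (inlM P Q) z.1 + mfun (inrM P Q) z.2).
  by rewrite inlME inrME; case: z => x y; congr pair; rewrite /= ?addr0 ?add0r.
rewrite {1}[z.1]hs {1}[z.2]ht !mfun_sum; congr (_ + _); apply: eq_bigr => x _.
  rewrite -[RHS]/(mact (mfun (inlM P Q) x.1) (mfun (compM x.2 (prlM P Q)) z)).
  by rewrite compME prlME mfunP.
rewrite -[RHS]/(mact (mfun (inrM P Q) x.1) (mfun (compM x.2 (prrM P Q)) z)).
by rewrite compME prrME mfunP.
Qed.

Lemma dual_basis_reg : @is_dual_basis (regM A) [:: (aone A, idM (regM A))].
Proof. by move=> a; rewrite big_seq1 idME /= amul1l. Qed.

Lemma dual_basis_free n : exists s, @is_dual_basis (freeM n) s.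
Proof.
elim: n => [|n [s IH]].
  by exists [::] => p; rewrite big_nil; apply: thinmx0.
by eexists; apply: (@dual_basis_dsum (regM A) (freeM n)) dual_basis_reg IH.
Qed.

Lemma dual_basis P : projective P -> exists s, @is_dual_basis P s.
Proof.
move=> /projective_retract_free[n [i [q qi]]]; have [s hs] := dual_basis_free n.
exists [seq (mfun (q : homM _ _) t.1, compM t.2 (i : homM P _)) | t <- s] => p.
rewrite big_map -[LHS](mod_cancel p qi).
rewrite [X in mfun (q : homM _ _) X]hs mfun_sum.
by apply: eq_bigr => t _; rewrite mfunP -compME.
Qed.

(** The functionals of a dual basis generate Hom (P, A) as a left module; the coefficients are the
    values of [u] on the basis. *)
Lemma dual_basis_hom P (s : seq (P * homM P (regM A))) (u : homM P (regM A)) :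
  is_dual_basis s ->
  u = \sum_(t <- s) lactM (mfun u t.1 : A) t.2.
Proof.
move=> hs; apply: homMP => p; rewrite [p in LHS]hs mfun_sum mfun_sumE.
by apply: eq_bigr => t _; rewrite mfunP lactME.
Qed.

Lemma nakayamaE P (psi : nakayama P) (a : A) (u : homM P (regM A)) :
  (mact psi a : 'Hom(_, _)) u = (psi : 'Hom(_, _)) (lactM a u).
Proof. exact: (linfunE (@nak_lin _ _ P a psi)). Qed.

Lemma nakmapE P Q (h : homM P Q) (psi : nakayama P) (u : homM Q (regM A)) :
  (mfun (nakmap h) psi : 'Hom(_, _)) u = (psi : 'Hom(_, _)) (compM u h).
Proof.
by rewrite [mfun (nakmap h) psi](linfunE (nakmap_lin2 h)) (linfunE (nakmap_lin1 h _)).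
Qed.

(* The transpose of  Hom (P, M)* -> Hom (M, nu P): for phi in Hom (P, M)*, the map
   m |-> (u |-> phi (p |-> m u(p))). *)
Section NakayamaHom.
Variables (P M : rmod A) (phi : 'Hom(homM P M, k^o)).

Lemma nakhom_lin1 (m : M) :
  linear (fun u : homM P (regM A) => phi (compM (genM m) u)).
Proof. by move=> c u v; rewrite compM_linr linearP. Qed.

Lemma nakhom_lin2 :
  linear (fun m : M => linfun (fun u : homM P (regM A) => phi (compM (genM m) u))
          : nakayama P).
Proof.
move=> c m n; apply/lfunP => u.
rewrite !(add_lfunE, scale_lfunE) !(linfunE (nakhom_lin1 _)) -linearP; congr (phi _).
by apply: homMP => p; rewrite mfunPE !compME !genME mact_linl.
Qed.

Lemma nakhom_equiv : equivariant (linfun (fun m : M =>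
  linfun (fun u : homM P (regM A) => phi (compM (genM m) u)) : nakayama P)
  : 'Hom(M, nakayama P)).
Proof.
move=> m a; rewrite !(linfunE nakhom_lin2); apply/lfunP => u.
rewrite nakayamaE !(linfunE (nakhom_lin1 _)); congr (phi _).
by apply: homMP => p; rewrite !compME !genME lactME mactA.
Qed.

Definition nakhom : homM M (nakayama P) := mkhomM nakhom_equiv.

Lemma nakhomE m u : (mfun nakhom m : 'Hom(_, _)) u = phi (compM (genM m) u).
Proof.
by rewrite [mfun nakhom m](linfunE nakhom_lin2) (linfunE (nakhom_lin1 m)).
Qed.
End NakayamaHom.

(* By the duality Hom (M, nu P) = Hom (P, M)* for projective P. *)
Lemma Hom_zero_kernel_nakmap P Q K M (D : homM P Q)
    (i : homM K (nakayama P)) :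
  projective P -> projective Q -> is_kernel i (nakmap D) ->
  Hom_zero M K <-> (forall h : homM P M, exists g, h = compM g D).
Proof.
move=> pP pQ [inj im]; have [s hs] := dual_basis pP; have [t ht] := dual_basis pQ.
split=> [MK h|fac f]; last first.
  apply: homMP => m; rewrite mfun0E; apply: inj; rewrite mfun0.
  have nF n (v : homM Q (regM A)) :
      (mfun i (mfun f n) : 'Hom(_, _)) (compM v D) = 0.
    rewrite -nakmapE.
    have : mfun i (mfun f n) \in lker (mfun (nakmap D)) by rewrite -im memv_img ?memvf.
    by rewrite memv_ker => /eqP ->; rewrite zero_lfunE.
  apply/lfunP => u; rewrite zero_lfunE (dual_basis_hom u hs) linear_sum /=.
  have [g eg] := fac (compM (genM m) u).
  pose F n (v : homM P (regM A)) := (mfun i (mfun f n) : 'Hom(_, _)) v.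
  (* Expanding [u] along the dual basis of [P] and then [D x.1] along that of [Q] moves all scalars
     to one side. After exchanging the sums, the inner one reassembles [y.2 D], on which [nF]
     applies. *)
  transitivity (\sum_(x <- s) \sum_(y <- t)
      F (mfun g y.1) (lactM (mfun (compM y.2 D) x.1 : A) x.2)).
    apply: eq_bigr => x _; rewrite -nakayamaE -!mfunP -[mact m _]genME -(compME (genM m) u) eg compME.
    rewrite [mfun D _ in LHS]ht !mfun_sum sum_lfunE; apply: eq_bigr => y _.
    by rewrite !mfunP nakayamaE compME.
  rewrite exchange_big big1 // => y _; rewrite -[RHS](nF (mfun g y.1) y.2).
  by rewrite [in RHS](dual_basis_hom (compM y.2 D) hs) linear_sum.
have [//|nh] := classic (exists g, h = compM g D).
pose U := limg (rcomp (C := mod) M D).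
have hU : h \notin U.
  by apply/negP => /memv_imgP[g _ e]; apply: nh; exists g; rewrite e rcompE.
have [phi [phih phiU]] := separating_functional hU.
(* [phi] vanishes on everything factoring through [D], so its transpose [nakhom phi] lands in the
   kernel of [nakmap D] and comes from a map [M -> K], zero by hypothesis. *)
have [|f fi] := inj_factor (f := nakhom phi) inj.
  move=> m; rewrite im memv_ker; apply/eqP/lfunP => u.
  rewrite nakmapE nakhomE zero_lfunE; apply: phiU; apply/memv_imgP.
  exists (compM (genM m) u); first exact: memvf.
  by rewrite rcompE; apply: (compmA (a := mod)).
suff : phi h = 0 by move/eqP; rewrite (negPf phih).
(* In this form [phi h] becomes a sum of values of [nakhom phi], all zero, against [phi h != 0]. *)
have -> : h = \sum_(x <- s) compM (genM (mfun h x.1)) x.2.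
  apply: homMP => p; rewrite [p in LHS]hs mfun_sum mfun_sumE.
  by apply: eq_bigr => x _; rewrite mfunP compME genME.
rewrite linear_sum big1 // => x _.
transitivity ((mfun (nakhom phi) (mfun h x.1) : 'Hom(_, _)) x.2).
  by rewrite nakhomE.
by rewrite -fi (MK f) compME mfun0E mfun0 zero_lfunE.
Qed.

End Mod.

Arguments lker_stable {k A M N} f.
Arguments limg_stable {k A M N} f.

(** * Projective resolutions *)

Section Ladders.
Variables (k : fieldType) (C : addcat k).
Implicit Types X Y Z W : C.

Definition head_target m X Y : chain m X Y -> C :=
  match m return chain m X Y -> C with
  | 0 => fun _ => Y
  | _.+1 => fun c => projT1 c
  end.

Definition head m X Y : forall c : chain m X Y, hom X (head_target c) :=
  match m return forall c : chain m X Y, hom X (head_target c) with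
  | 0 => fun f => f
  | _.+1 => fun c => (projT2 c).1
  end.

(** A [ladder] with existentially quantified interior maps, so that comparison maps compose without
    recording rungs. *)
Fixpoint chain_map m X Y X' Y' : chain m X Y -> chain m X' Y' ->
    hom X X' -> hom Y Y' -> Prop :=
  match m return chain m X Y -> chain m X' Y' -> hom X X' -> hom Y Y' -> Prop with
  | 0 => fun f f' u v => v \oc f = f' \oc u
  | m'.+1 => fun c c' u v =>
      exists w : hom (projT1 c) (projT1 c'),
        w \oc (projT2 c).1 = (projT2 c').1 \oc u
        /\ chain_map (projT2 c).2 (projT2 c').2 w v
  end.

Lemma chain_map_id m X Y (c : chain m X Y) : chain_map c c (idm X) (idm Y).
Proof.
elim: m X c => [|m IH] X c /=; first by rewrite comp1m compm1.
by exists (idm _); rewrite comp1m compm1.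
Qed.

Lemma chain_map_comp m X Y X' Y' X'' Y'' (c : chain m X Y) (c' : chain m X' Y')
    (c'' : chain m X'' Y'') u v u' v' :
  chain_map c c' u v -> chain_map c' c'' u' v' ->
  chain_map c c'' (u' \oc u) (v' \oc v).
Proof.
elim: m X X' X'' c c' c'' u u' => [|m IH] X X' X'' c c' c'' u u' /=.
  by move=> e e'; rewrite -compmA e compmA e' compmA.
move=> [w [e h]] [w' [e' h']]; exists (w' \oc w); split; last exact: IH h h'.
by rewrite -compmA e compmA e' compmA.
Qed.

Lemma chain_map_head m X Y X' Y' (c : chain m X Y) (c' : chain m X' Y') u v :
  chain_map c c' u v -> exists w, w \oc head c = head c' \oc u.
Proof. by case: m c c' => [|m] c c' /=; [exists v | case=> w [e _]; exists w]. Qed.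

(** Surjectivity of Hom (-, Z) on the first map. For a minimal resolution cut at degree d,
    [Hom_zero_kernel_nakmap] identifies it with Hom (Z, tau_d N) = 0. *)
Definition factors_head m X Y (c : chain m X Y) Z :=
  forall h : hom X Z, exists g, h = g \oc head c.

Lemma factors_head_iso m X Y (c : chain m X Y) Z Z' :
  iso Z Z' -> factors_head c Z -> factors_head c Z'.
Proof.
move=> [f [f' [_ ff']]] cZ h; have [g e] := cZ (f' \oc h).
by exists (f \oc g); rewrite -compmA -e compmA ff' comp1m.
Qed.

(** By the homotopy relation, [psi phi - s (head c)] differs from the identity by an endomorphism
    killed by [head c], so it has an inverse [r]. Then [h = h r psi phi - h r s (head c)], where
    [h r psi] extends along [head c'] and the last term visibly factors through [head c]. *)
Lemma factors_head_transfer m X Y X' Y' (c : chain m X Y) (c' : chain m X' Y')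
    (phi : hom X X') (psi : hom X' X) v s Z :
  chain_map c c' phi v ->
  head c \oc (psi \oc phi - idm X) = head c \oc (s \oc head c) ->
  (forall t : hom X X, head c \oc t = 0 -> is_iso (idm X - t)) ->
  factors_head c' Z -> factors_head c Z.
Proof.
move=> /chain_map_head[w ew] es hc fc' h.
have [|r [r1 _]] := hc (idm X + s \oc head c - psi \oc phi).
  apply/eqP; rewrite [idm X + _]addrC -addrA compmDr -es -compmDr.
  by rewrite addrA subrK subrr compm0.
have [g eg] := fc' (h \oc r \oc psi).
exists (g \oc w - h \oc r \oc s).
rewrite compmBl -(compmA g w) ew compmA -eg -!compmA -!compmBr.
have -> : psi \oc phi - s \oc head c = idm X - (idm X + s \oc head c - psi \oc phi).
  by rewrite -addrA opprD addrA subrr add0r opprB.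
by rewrite r1 compm1.
Qed.
Lemma homotopy_step X Z X' Z' V (f : hom X Z) (f' : hom X' Z') (u u' : hom X X')
    (w w' : hom Z Z') (h : hom Z V) (s : hom V Z') (t : hom Z X') :
  w \oc f = f' \oc u -> w' \oc f = f' \oc u' -> h \oc f = 0 ->
  f' \oc t = w - w' - s \oc h -> f' \oc (u - u') = f' \oc (t \oc f).
Proof.
move=> e e' hf ft; rewrite compmA ft !compmBl compmBr e e' -compmA hf.
by rewrite compm0 subr0.
Qed.
End Ladders.

Section Resolutions.
Variables (k : fieldType) (A : fdalg k).
Local Notation mod := (modcat A).
Implicit Types L M N P Q : mod.

(** A truncated projective resolution: nothing is asked of the kernel of the leftmost map. *)
Fixpoint resolution m P N : chain m P N -> Prop :=
  match m return chain m P N -> Prop with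
  | 0 => fun f => projective P /\ surjM (f : homM P N)
  | m'.+1 => fun c =>
      [/\ projective P,
          limg (mfun ((projT2 c).1 : homM P _))
          = lker (mfun (head (projT2 c).2 : homM _ _))
        & resolution (projT2 c).2]
  end.

Lemma proj_lift P M N (g : homM M N) (f : homM P N) :
  projective P -> (forall x, mfun f x \in limg (mfun g)) ->
  exists h : homM P M, compM g h = f.
Proof.
move=> pP im; have [f' e'] := sub_factor (limg_stable g) im.
have [g' eg'] := @sub_factor _ _ M N _ (limg_stable g) g (fun x => memv_img _ (memvf x)).
have [|h eh] := pP _ _ g' f'.
  apply/surjMP => y; have /memv_imgP[x _ ex] := inclM_mem y.
  by exists x; apply: inclM_inj; rewrite -compME eg' ex.
exists h; apply: homMP => x.
by rewrite compME -eg' compME -(compME g') eh -compME e'.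
Qed.

Lemma resolution_head m L P N (c : chain m P N) (f : hom L P) :
  resolution (link f c) -> head c \oc f = 0.
Proof. by move=> [_ /limg_eq_lker[]]. Qed.

Lemma resolution_source m P N (c : chain m P N) : resolution c -> projective P.
Proof. by case: m c => [|m] c []. Qed.

Lemma resolution_lift m P N P' N' (c : chain m P N) (c' : chain m P' N') v :
  resolution c -> resolution c' -> exists u, chain_map c c' u v.
Proof.
elim: m P P' c c' => [|m IH] P P' c c'.
  move=> [pP _] [_ sc]; have [u e] := pP _ _ (c' : homM _ _) (compM v (c : homM _ _)) sc.
  by exists u.
case: c c' => [Z [f c]] [Z' [f' c']] rc rc'.
have hf := resolution_head rc; case: rc rc' => [pP _ rc] [_ e' rc'].
have [w cw] := IH _ _ c c' rc rc'; have [w' ew'] := chain_map_head cw.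
have [|u eu] := @proj_lift P _ _ (f' : homM _ _) (compM w (f : homM _ _)) pP.
  move=> x; rewrite e' memv_ker.
  have e : head c' \oc (w \oc f) = 0 by rewrite compmA -ew' -compmA hf compm0.
  by have := mfun_eq x e; rewrite (compME (head c')) mfun0E => ->.
by exists u, w.
Qed.

(** Uniqueness of lifts up to homotopy. At the left end of a truncated resolution there is no
    further term to carry a homotopy, so the relation is stated after composing with [head c']. *)
Lemma resolution_homotopy m P N P' N' (c : chain m P N) (c' : chain m P' N') v u u' :
  resolution c -> resolution c' -> chain_map c c' u v -> chain_map c c' u' v ->
  exists s : hom (head_target c) P',
    head c' \oc (u - u') = head c' \oc (s \oc head c).
Proof.
elim: m P P' c c' u u' => [|m IH] P P' c c' u u'.
  move=> _ _ e e'; exists 0; rewrite comp0m compm0 compmBr.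
  by apply/eqP; rewrite subr_eq0; apply/eqP; apply: etrans (esym e) e'.
case: c c' => [Z [f c]] [Z' [f' c']] rc rc' [w [ew cw]] [w' [ew' cw']].
have hf := resolution_head rc; case: rc rc' => [_ _ rc] [_ e' rc'].
have [s es] := IH _ _ c c' w w' rc rc' cw cw'.
have pZ := resolution_source rc.
have [|t et] := @proj_lift Z _ _ (f' : homM _ _) (w - w' - (s \oc head c)) pZ.
  move=> x; rewrite e' memv_ker.
  have e : head c' \oc (w - w' - s \oc head c) = 0 by rewrite compmBr es subrr.
  by have := mfun_eq x e; rewrite (compME (head c')) mfun0E => ->.
exists t; exact: (homotopy_step ew ew' hf et).
Qed.

(** The condition on [t] excludes nonzero summands of [P] on which [head c] vanishes: a nonzero map
    from such a summand to [M] could not extend. *)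
Lemma factors_head_resolution m P N P' N' (c : chain m P N) (c' : chain m P' N') M :
  resolution c -> resolution c' -> iso N N' ->
  (forall t : hom P P, head c \oc t = 0 -> is_iso (idm P - t)) ->
  factors_head c' M -> factors_head c M.
Proof.
move=> rc rc' [v [v' [v1 _]]] hc fc'.
have [u cu] := resolution_lift v rc rc'; have [u' cu'] := resolution_lift v' rc' rc.
have := chain_map_comp cu cu'; rewrite v1 => cu''.
have [s es] := resolution_homotopy rc rc cu'' (chain_map_id c).
exact: factors_head_transfer cu es hc fc'.
Qed.

(** Take a projective surjection of minimal dimension. If [V + ker f] is everything, [f] lifts
    through [V] to an endomorphism [e] of [P] with [f e = f]. The Fitting idempotent of [e] has a
    projective image still mapping onto [M], so by minimality this image is [P]; it lies in the
    image of [e], hence in [V]. *)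
Lemma exists_proj_cover M : exists (P : rmod A) (f : homM P M),
  [/\ projective P, surjM f & superfluous (lker (mfun f))].
Proof.
pose covers := {P : rmod A & {f : homM P M | projective P /\ surjM f}}.
have [n [f0 sf0]] := exists_free_cover M.
pose cov0 : covers := existT _ _ (exist _ f0 (conj (@projective_free _ A n) sf0)).
have [[P [f [pP sf]]] fmin] :=
  ex_minimizer cov0 (fun c => \dim (fullv : {vspace projT1 c})).
exists P, f; split=> // V sV VU; pose j := inclM sV.
have [|h eh] := pP _ _ (compM f j) f.
  apply/surjMP => y; have /surjMP/(_ y)[x <-] := sf.
  have : x \in (V + lker (mfun f))%VS by rewrite VU memvf.
  move=> /memv_addP[v /(inclM_surj sV)[v' ev] [u]]; rewrite memv_ker => /eqP fu ->.
  by exists v'; rewrite compME ev mfunD fu addr0.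
pose e : hom (P : mod) P := compM j h.
have fe n' : (f : hom (P : mod) M) \oc epow e n' = f.
  elim: n' => [|n' IH]; first by rewrite compm1.
  have fe1 : (f : hom (P : mod) M) \oc e = f by rewrite -[RHS]eh; apply: (compmA (a := mod)).
  by rewrite epowS compmA fe1.
have [n' [c [xx ex]]] := fitting e.
have [x xE] : {x | x = epow e n'.+1 \oc c} by exists (epow e n'.+1 \oc c).
rewrite -xE in xx ex.
have fx : (f : hom (P : mod) M) \oc x = f by rewrite -(fe n'.+1) -compmA ex.
have [Z [p [i [pi ip]]]] := mod_split_idempotents xx.
have pz : projective Z /\ surjM (compM f (i : homM _ _)).
  split; first by apply: (projective_retract pP); exists i, p.
  apply/surjMP => y; have /surjMP/(_ y)[z <-] := sf; exists (mfun (p : homM P Z) z).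
  by rewrite -(mfun_eq z fx) -ip compME (compME f) (compME i).
have := fmin (existT _ Z (exist _ _ pz)) => /= dPZ.
have ii : (lker (mfun (i : homM Z P)) == 0)%VS.
  by apply/lker0P => a b eab; rewrite -(mod_cancel a pi) eab (mod_cancel b pi).
have si : surjM (i : homM Z P).
  apply/eqP; rewrite eqEdim subvf limg_dim_eq //.
  by rewrite capfv; apply/eqP.
apply/eqP; rewrite eqEsubv subvf; apply/subvP => y _.
have /surjMP/(_ y)[z <-] := si.
have -> : mfun (i : homM Z P) z = mfun (x : homM P P) (mfun (i : homM Z P) z).
  by rewrite -ip (compME i) (mod_cancel z pi).
rewrite xE epowS -compmA (compME e) (compME j); exact: inclM_mem.
Qed.

End Resolutions.

(** * Minimal resolutions and vanishing of Hom into tau_d *)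

Section MinimalResolution.
Variables (k : fieldType) (A : fdalg k).
Local Notation mod := (modcat A).
Implicit Types L M N P Q : rmod A.

(** The terms of a resolution are data defined by recursion, so a cover of each syzygy has to be
    chosen. *)
Lemma proj_cover_sig M : {c : {P : rmod A & homM P M} |
  [/\ projective (projT1 c), surjM (projT2 c) & superfluous (lker (mfun (projT2 c)))]}.
Proof.
apply: constructive_indefinite_description.
by have [P [f h]] := exists_proj_cover M; exists (existT _ P f).
Qed.

Definition pcover M : rmod A := projT1 (sval (proj_cover_sig M)).
Definition pcover_map M : homM (pcover M) M := projT2 (sval (proj_cover_sig M)).

Lemma pcover_proj M : projective (pcover M).
Proof. by have [] := svalP (proj_cover_sig M). Qed.
Lemma pcover_surj M : surjM (pcover_map M).
Proof. by have [] := svalP (proj_cover_sig M). Qed.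
Lemma pcover_min M : superfluous (lker (mfun (pcover_map M))).
Proof. by have [] := svalP (proj_cover_sig M). Qed.

Fixpoint syzygy M i : rmod A :=
  if i is i'.+1 then subM (lker_stable (pcover_map (syzygy M i'))) else M.

Definition syzygy_diff M i : homM (pcover (syzygy M i.+1)) (pcover (syzygy M i)) :=
  compM (inclM (lker_stable (pcover_map (syzygy M i)))) (pcover_map (syzygy M i.+1)).

Lemma limg_syzygy_diff M i :
  limg (mfun (syzygy_diff M i)) = lker (mfun (pcover_map (syzygy M i))).
Proof.
rewrite [mfun _]/= limg_comp.
by rewrite [limg _](@pcover_surj (syzygy M i.+1)) limg_inclM.
Qed.

Lemma lker_syzygy_diff M i :
  lker (mfun (syzygy_diff M i)) = lker (mfun (pcover_map (syzygy M i.+1))).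
Proof.
apply/vspaceP => x; rewrite !memv_ker compME -[X in _ == X](mfun0 (inclM (lker_stable (pcover_map (syzygy M i))))).
by rewrite (inj_eq (@inclM_inj _ _ _ _ _)).
Qed.

Definition min_resolution M : min_proj_resolution M.
Proof.
refine (@MinProjResolution k A M (fun i => pcover (syzygy M i)) (syzygy_diff M)
  (pcover_map M) (fun i => @pcover_proj _) (@pcover_surj M) _ _ (@pcover_min M) _).
- exact: limg_syzygy_diff.
- by move=> i; rewrite limg_syzygy_diff lker_syzygy_diff.
- by move=> i; rewrite lker_syzygy_diff; apply: pcover_min.
Defined.

Fixpoint resolution_chain M (R : min_proj_resolution M) i :
    @chain k mod i (rterm R i) M :=
  match i return @chain k mod i (rterm R i) M with
  | 0 => raug R
  | i'.+1 => link (rdiff R i' : @hom k mod _ _) (resolution_chain R i')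
  end.

Lemma resolution_chainP M (R : min_proj_resolution M) i :
  resolution (resolution_chain R i).
Proof.
elim: i => [|i IH]; first by split; [apply: rterm_proj | apply: raug_surj].
split; [exact: rterm_proj | | exact: IH].
by case: i {IH} => [|i]; [apply: raug_exact | apply: rdiff_exact].
Qed.

Lemma superfluous_1B M N (f : homM M N) (t : homM M M) :
  superfluous (lker (mfun f)) -> compM f t = 0 ->
  @is_iso k mod M M (@idm k mod M - t).
Proof.
move=> sf ft; pose u : homM M M := @idm k mod M - t.
apply: (@surjM_iso _ _ M u); apply: sf; first exact: limg_stable.
apply/eqP; rewrite eqEsubv subvf; apply/subvP => x _.
have -> : x = mfun u x + mfun t x by rewrite -mfunDE /u subrK; apply/esym/idME.
rewrite memv_add ?memv_img ?memvf //.
by rewrite memv_ker -compME ft mfun0E.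
Qed.

(** Makes [Hom_tau_zero] computable from a resolution that need not be minimal, and shows that the
    choice of [R] in [is_tau] does not matter. Both [c] and the minimal resolution satisfy the
    condition on [t], so the extension property transfers both ways. *)
Lemma Hom_tau_zeroP d M N P N' (c : @chain k mod d.+1 P N') :
  resolution c -> isoM N N' ->
  (forall t : @hom k mod P P, head c \oc t = 0 -> is_iso (idm (P : mod) - t)) ->
  Hom_tau_zero d.+1 M N <-> @factors_head k mod _ _ _ c M.
Proof.
move=> rc NN' hc.
have hR (R : min_proj_resolution N) :
    (forall h : homM (rterm R d.+1) M, exists g, h = compM g (rdiff R d))
    <-> @factors_head k mod _ _ _ c M.
  pose cR := resolution_chain R d.+1.
  have rR : resolution cR := resolution_chainP R d.+1.
  split=> h; first exact: (factors_head_resolution (c' := cR) rc rR (iso_sym NN') hc h).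
  apply: (factors_head_resolution (c := cR) rR rc NN' _ h) => t ft.
  by apply: (@superfluous_1B _ _ (rdiff R d) t _ ft); apply: rdiff_min.
have hK (R : min_proj_resolution N) K (i : homM K _) (hi : is_kernel i (nakmap (rdiff R d))) :
    Hom_zero M K <-> @factors_head k mod _ _ _ c M.
  by rewrite -(hR R); apply: Hom_zero_kernel_nakmap hi; apply: rterm_proj.
split=> [[K [[R [i hi]] MK]]|h]; first by apply/(hK R K i hi).
pose R := min_resolution N.
pose sK := lker_stable (nakmap (rdiff R d)).
have hi : is_kernel (inclM sK) (nakmap (rdiff R d)).
  by split; [exact: inclM_inj | exact: limg_inclM].
by exists (subM sK); split; [exists R, (inclM sK) | apply/(hK R _ _ hi)].
Qed.

End MinimalResolution.

Section Sums.
Variables (k : fieldType) (C : addcat k).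
Hypothesis hsplit : split_idempotents C.
Implicit Types X Y Z W : C.

Lemma iso_bipC X Y : iso (X \(+) Y) (Y \(+) X).
Proof.
apply: (iso_split (prr_inr Y X) (prl_inl Y X)).
by rewrite addrC bip_split.
Qed.

Lemma iso_bip_shuffle X Y Z W :
  iso ((X \(+) Y) \(+) (Z \(+) W)) ((X \(+) Z) \(+) (Y \(+) W)).
Proof.
apply: iso_trans (iso_sym (iso_bipA _ _ _)) _.
apply: iso_trans _ (iso_bipA _ _ _); apply: iso_bip (iso_refl _) _.
apply: iso_trans (iso_bipA _ _ _) _.
apply: iso_trans _ (iso_sym (iso_bipA _ _ _)); apply: iso_bip _ (iso_refl _).
exact: iso_bipC.
Qed.

Lemma in_add_bip_split X W Z : in_add (X \(+) W) Z ->
  exists A B, [/\ in_add X A, in_add W B & retract Z (A \(+) B)].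
Proof.
move: Z; apply: in_add_ind.
- by exists zob, zob; split; try exact: in_add_zob; apply: retract_zob.
- by exists X, W; split; try exact: in_add_refl; apply: retract_refl.
- move=> Y Z [A [B [XA WB r]]] [A' [B' [XA' WB' r']]].
  exists (A \(+) A'), (B \(+) B'); split; try exact: (in_add_bip hsplit).
  apply: retract_trans (retract_bip r r') _.
  exact/iso_retract/iso_bip_shuffle.
- move=> Y Z [A [B [XA WB r]]] r'; exists A, B; split=> //.
  exact: retract_trans r' r.
Qed.
End Sums.

(** * The functor T(T, -) *)

Section HomFunctor.
Variables (k : fieldType) (C : addcat k) (T : C).
Implicit Types X Y Z W P Q : C.
Notation H := (homT T).
Notation mod := (modcat (end_alg T)).

Lemma Hmap_lin X Y (f : hom X Y) : linear (fun x : H X => (f \oc x : H Y)).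
Proof. exact: compm_linr. Qed.

Lemma Hmap_equiv X Y (f : hom X Y) :
  equivariant (linfun (fun x : H X => (f \oc x : H Y)) : 'Hom(H X, H Y)).
Proof. by move=> x a; rewrite !(linfunE (Hmap_lin f)) /= compmA. Qed.

Definition Hmap X Y (f : hom X Y) : @hom k mod (H X) (H Y) := mkhomM (Hmap_equiv f).

Lemma HmapE X Y (f : hom X Y) (x : hom T X) :
  mfun (Hmap f : homM (H X) (H Y)) x = f \oc x.
Proof. exact: (linfunE (Hmap_lin f)). Qed.

Lemma Hmap_ext X Y (phi : @hom k mod (H X) (H Y)) (f : hom X Y) :
  (forall x : hom T X, mfun (phi : homM (H X) (H Y)) x = f \oc x) -> phi = Hmap f.
Proof. by move=> h; apply: homMP => x; rewrite h HmapE. Qed.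

Lemma Hmap_id X : Hmap (idm X) = idm (H X : mod).
Proof. by apply/esym/Hmap_ext => x; rewrite idME comp1m. Qed.

Lemma Hmap_comp X Y Z (g : hom Y Z) (f : hom X Y) :
  Hmap (g \oc f) = Hmap g \oc Hmap f.
Proof. by apply/esym/Hmap_ext => x; rewrite (compME (Hmap g)) !HmapE compmA. Qed.

Lemma HmapD X Y (f g : hom X Y) : Hmap (f + g) = Hmap f + Hmap g.
Proof. by apply/esym/Hmap_ext => x; rewrite mfunDE !HmapE compmDl. Qed.

Lemma Hmap0 X Y : Hmap (0 : hom X Y) = 0.
Proof. by apply: (@addrI _ (Hmap 0)); rewrite -HmapD !addr0. Qed.

Lemma HmapN X Y (f : hom X Y) : Hmap (- f) = - Hmap f.
Proof. by apply: (@addrI _ (Hmap f)); rewrite -HmapD !subrr Hmap0. Qed.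

Lemma HmapB X Y (f g : hom X Y) : Hmap (f - g) = Hmap f - Hmap g.
Proof. by rewrite HmapD HmapN. Qed.

Lemma Hmap_is_iso X Y (f : hom X Y) : is_iso f -> is_iso (Hmap f).
Proof.
by move=> [g [gf fg]]; exists (Hmap g); rewrite -!Hmap_comp gf fg !Hmap_id.
Qed.

Lemma Hmap_iso X Y : iso X Y -> isoM (H X) (H Y).
Proof. by move=> [f /Hmap_is_iso fi]; exists (Hmap f). Qed.

Lemma Hmap_retract X Y : retract X Y -> @retract k mod (H X) (H Y).
Proof.
by move=> [i [p pi]]; exists (Hmap i), (Hmap p); rewrite -Hmap_comp pi Hmap_id.
Qed.

Lemma Hmap_bip X Y : @iso k mod ((H X : mod) \(+) (H Y : mod)) (H (X \(+) Y)).
Proof.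
apply: (@iso_split k mod _ _ _ (Hmap (inl_ X Y)) (Hmap (prl X Y))
                   (Hmap (inr_ X Y)) (Hmap (prr X Y))).
- by rewrite -Hmap_comp prl_inl Hmap_id.
- by rewrite -Hmap_comp prr_inr Hmap_id.
- by rewrite -!Hmap_comp -HmapD bip_split Hmap_id.
Qed.

Lemma Hmap_copies X n : @retract k mod (@copies k mod (H X) n) (H (copies X n)).
Proof.
elim: n => [|n IH]; first exact: (@retract_zob k mod).
apply: retract_trans (iso_retract (Hmap_bip X (copies X n))).
exact: (@retract_bip k mod) (@retract_refl k mod _) IH.
Qed.

Lemma Hmap_zero X : (forall x : hom T X, x = 0) -> @is_zero_obj k mod (H X).
Proof.
by move=> X0; apply/zero_objP; apply: homMP => x; rewrite mfun0E idME; apply: X0.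
Qed.

Lemma Hmap_in_add X Y : in_add X Y -> addM (H X) (H Y).
Proof.
move: Y; apply: in_add_ind => [||Y Z hY hZ|Y Z hY r].
- apply: in_add_iso (in_add_zob _); apply/iso_sym/Hmap_zero => x.
  exact: hom_to_zob.
- exact: (@in_add_refl k mod).
- apply: in_add_iso (Hmap_bip Y Z) _.
  exact: (in_add_bip (@mod_split_idempotents k (end_alg T))) hY hZ.
- exact: (in_add_retract (@mod_split_idempotents k (end_alg T))) hY (Hmap_retract r).
Qed.

(** Yoneda: on [T] itself, evaluate at the identity; sums and retracts follow. Fullness from [add T]
    has the same origin. *)
Lemma Hmap_faithful P X (f : hom P X) : in_add T P -> Hmap f = 0 -> f = 0.
Proof.
move=> TP; have h : Hmap f = 0 -> forall x : hom T P, f \oc x = 0.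
  by move=> f0 x; rewrite -HmapE f0 mfun0E.
move=> /h {h}; elim/in_add_ind: P / TP f => [f _|f h|P Q IP IQ f h|P Q IP r f h].
- exact: hom_from_zob.
- by rewrite -[f]compm1 h.
- have e1 : f \oc inl_ P Q = 0 by apply: IP => x; rewrite -compmA h.
  have e2 : f \oc inr_ P Q = 0 by apply: IQ => x; rewrite -compmA h.
  by rewrite -[f]compm1 -(bip_split P Q) compmDr !compmA e1 e2 !comp0m addr0.
- case: r => [i [p pi]].
  have e : f \oc p = 0 by apply: IP => x; rewrite -compmA h.
  by rewrite -[f]compm1 -pi compmA e comp0m.
Qed.

Lemma Hmap_full_add P X (phi : @hom k mod (H P) (H X)) :
  in_add T P -> exists f, phi = Hmap f.
Proof.
move=> TP; elim/in_add_ind: P / TP phi => [phi|phi|P Q IP IQ phi|P Q IP r phi].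
- exists 0; apply: Hmap_ext => x; rewrite comp0m (hom_to_zob x).
  exact: (mfun0 (phi : homM _ _)).
- exists (mfun (phi : homM (H T) (H X)) (idm T)); apply: Hmap_ext => x.
  apply: etrans (mfunP (phi : homM (H T) (H X)) (idm T) x).
  by congr (mfun _ _); apply/esym/comp1m.
- have [f ef] := IP (phi \oc Hmap (inl_ P Q)).
  have [g eg] := IQ (phi \oc Hmap (inr_ P Q)).
  exists (f \oc prl P Q + g \oc prr P Q).
  rewrite HmapD !Hmap_comp -ef -eg -!compmA -!Hmap_comp -compmDr -HmapD bip_split.
  by rewrite Hmap_id compm1.
- case: r => [i [p pi]]; have [f ef] := IP (phi \oc Hmap p).
  by exists (f \oc i); rewrite Hmap_comp -ef -compmA -Hmap_comp pi Hmap_id compm1.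
Qed.

Lemma Hmap_proj P : in_add T P -> projective (H P).
Proof.
move=> TP; elim/in_add_ind: P / TP => [||P Q IP IQ|P Q IP r].
- apply: (projective_retract (@projective_zero k (end_alg T))).
  apply: (@iso_retract k mod); apply: Hmap_zero => x; exact: hom_to_zob.
- exact: projective_reg.
- apply: projective_retract (projective_dsum IP IQ) _.
  exact/iso_retract/iso_sym/Hmap_bip.
- exact: projective_retract IP (Hmap_retract r).
Qed.

Hypothesis hsplit : split_idempotents C.

(** [Q] is the image of an idempotent on [H] of a power of [T]. By full faithfulness there, the
    idempotent comes from one of that power, which splits. *)
Lemma proj_is_H (Q : rmod (end_alg T)) :
  projective Q -> exists P, in_add T P /\ isoM (H P) Q.
Proof.
move=> /projective_retract_free[n r].
have [i [p pi]] : @retract k mod Q (H (copies T n)).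
  exact: retract_trans r (Hmap_copies T n).
have TT : in_add T (copies T n).
  by apply/(in_addP hsplit); exists n; apply: retract_refl.
have [e ee] := Hmap_full_add (i \oc p) TT.
have [|P [q [j [qj jq]]]] := hsplit (e := e).
  apply/eqP; rewrite -subr_eq0; apply/eqP; apply: Hmap_faithful => //.
  rewrite HmapB Hmap_comp -ee -!compmA (compmA p) pi comp1m subrr //.
exists P; split; first by apply: (in_add_retract hsplit TT); exists j, q.
exists (p \oc Hmap j), (Hmap q \oc i); split.
  by rewrite -compmA (compmA i) ee -!Hmap_comp -jq -!compmA qj compm1 qj Hmap_id.
by rewrite -compmA (compmA (Hmap j)) -Hmap_comp jq -ee -compmA !compmA pi comp1m pi.
Qed.

End HomFunctor.

(** * Vanishing of Ext and summands in add (S T) *)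

Section ExtZero.
Variables (k : fieldType) (C : addcat k) (d : nat) (S : angulation C d.+1).
Implicit Types X Y Z W : C.

Lemma Ext_zero_retract X X' Y Y' :
  retract X' X -> retract Y' Y -> Ext_zero S X Y -> Ext_zero S X' Y'.
Proof.
move=> [i [p pi]] /(susp_retract S)[j [q qj]] XY f.
have e : j \oc (f \oc p) = 0 by apply: XY.
rewrite -[f]compm1 -pi -[f]comp1m -qj -!compmA (compmA f) (compmA j) e.
by rewrite comp0m compm0.
Qed.

Lemma Ext_zero_bipl X X' Y :
  Ext_zero S (X \(+) X') Y <-> Ext_zero S X Y /\ Ext_zero S X' Y.
Proof.
split=> [h|[h h'] f].
  split; apply: Ext_zero_retract (retract_refl Y) h.
    exact: retract_bip_l.
  exact: retract_bip_r.
have e : f \oc inl_ X X' = 0 by apply: h.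
have e' : f \oc inr_ X X' = 0 by apply: h'.
by rewrite -[f]compm1 -(bip_split X X') compmDr !compmA e e' !comp0m addr0.
Qed.

Lemma Ext_zero_bipr X Y Y' :
  Ext_zero S X (Y \(+) Y') <-> Ext_zero S X Y /\ Ext_zero S X Y'.
Proof.
split=> [h|[h h'] f].
  split; apply: (Ext_zero_retract (retract_refl X) _ h).
    exact: retract_bip_l.
  exact: retract_bip_r.
have e : suspm S (prl Y Y') \oc f = 0 by apply: h.
have e' : suspm S (prr Y Y') \oc f = 0 by apply: h'.
rewrite -[f]comp1m -suspm_id -(bip_split Y Y') suspmD !suspm_comp compmDl -!compmA.
by rewrite e e' !compm0 addr0.
Qed.

Lemma Ext_zero_bip4 X X' Y Y' : Ext_zero S (X \(+) X') (Y \(+) Y') <->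
  [/\ Ext_zero S X Y, Ext_zero S X Y', Ext_zero S X' Y & Ext_zero S X' Y'].
Proof.
rewrite Ext_zero_bipl !Ext_zero_bipr.
by split=> [[[? ?] [? ?]]|[]].
Qed.

Lemma Ext_zero_zobl Y : Ext_zero S zob Y.
Proof. by move=> f; apply: hom_from_zob. Qed.

Lemma Ext_zero_zobr X : Ext_zero S X zob.
Proof.
move=> f; have /zero_objP e := susp_zero S (iso_refl (zob : C)).
by rewrite -[f]comp1m e comp0m.
Qed.

Lemma Ext_zero_in_add X X' Y Y' :
  in_add X X' -> in_add Y Y' -> Ext_zero S X Y -> Ext_zero S X' Y'.
Proof.
move=> XX' YY' h; have {}h : Ext_zero S X' Y.
  elim/in_add_ind: X' / XX' => // [|A B hA hB|A B hA r].
  - exact: Ext_zero_zobl.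
  - by apply/Ext_zero_bipl.
  - exact: Ext_zero_retract r (retract_refl _) hA.
elim/in_add_ind: Y' / YY' => // [|A B hA hB|A B hA r].
- exact: Ext_zero_zobr.
- by apply/Ext_zero_bipr.
- exact: Ext_zero_retract (retract_refl _) r hA.
Qed.

Lemma dual_eq0 (V : vectType k) : (forall phi : 'Hom(V, k^o), phi = 0) -> forall v : V, v = 0.
Proof.
move=> V0 v; apply/eqP; apply: contraT; rewrite -memv0.
by move=> /separating_functional[phi [+ _]]; rewrite (V0 phi) zero_lfunE eqxx.
Qed.

Hypothesis hCY : calabi_yau_2d S.

(** Duality makes Hom (A, S B) the dual of Hom (S B, S S A), and the latter is Hom (B, S A) because
    [S] is fully faithful. *)
Lemma Ext_zero_sym X Y : Ext_zero S X Y <-> Ext_zero S Y X.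
Proof.
suff h A B : Ext_zero S A B -> Ext_zero S B A by split; apply: h.
have [theta [bij _ _]] := hCY => AB f.
suff f0 : suspm S f = 0 by apply: suspm_eq0 f0.
move: (suspm S f); apply: dual_eq0 => phi.
have [g _ gK] := bij A (susp S B).
have g0 : g phi = 0 by apply: AB.
by rewrite -(gK phi) g0; exact: linear0.
Qed.

Section Rigid.
Hypothesis hsplit : split_idempotents C.
Hypothesis hind : forall X : C, indecomposable X -> d_rigid S X.

(** Ext (Y, X) = 0 comes by symmetry, but Ext (Y, Y) = 0 is given for indecomposable [Y] only, so
    [Y] is split by induction on the dimension of its endomorphisms. Summands inherit Ext (X, -) = 0
    and [add X] is closed under sums, so Ext between distinct summands never has to be examined. *)
Lemma maximal_d_rigidP X :
  maximal_d_rigid S X <-> (forall Y, in_add X Y <-> Ext_zero S X Y).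
Proof.
split=> hX; last first.
  move=> Y; split=> [XY|/Ext_zero_bip4[_ h _ _]]; last exact/hX.
  have XX : Ext_zero S X X by apply/hX; apply: in_add_refl.
  have h := in_add_bip hsplit (in_add_refl X) XY.
  exact: (Ext_zero_in_add h h XX).
move=> Y; split=> [/hX/Ext_zero_bip4[] //|].
have XX : Ext_zero S X X by have /hX/Ext_zero_bip4[] := in_add_zob X.
have [n] := ubnP (\dim (fullv : {vspace hom Y Y})); elim: n Y => // n IH Y nY XY.
have [Y0|nY0] := classic (is_zero_obj Y).
  exact: in_add_iso (iso_sym Y0) (in_add_zob X).
have [iY|] := classic (indecomposable Y).
  by apply/hX/Ext_zero_bip4; split=> //; [apply/Ext_zero_sym | apply: hind].
move=> niY; have [A [B [e nA nB]]] : exists A B,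
    [/\ iso Y (A \(+) B), ~ is_zero_obj A & ~ is_zero_obj B].
  apply: NNPP => h; apply: niY; split=> // A B e.
  have [?|nA] := classic (is_zero_obj A); first by left.
  have [?|nB] := classic (is_zero_obj B); first by right.
  by case: h; exists A, B.
apply: in_add_iso (iso_sym e) _; apply: in_add_bip => //; apply: IH.
- exact: leq_trans (dim_end_bip e nB) _.
- exact: Ext_zero_retract (retract_refl _) (retract_trans (retract_bip_l A B) (iso_retract (iso_sym e))) XY.
- exact: leq_trans (dim_end_bip (iso_trans e (iso_bipC A B)) nA) _.
- exact: Ext_zero_retract (retract_refl _) (retract_trans (retract_bip_r A B) (iso_retract (iso_sym e))) XY.
Qed.
End Rigid.
End ExtZero.

Section NoSuspSummand.
Variables (k : fieldType) (C : addcat k) (d : nat) (S : angulation C d.+1) (T : C).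
Hypothesis hsplit : split_idempotents C.
Implicit Types X Y Z W A B P Q : C.

(* For split idempotents: X has no nonzero direct summand in add (S T). *)
Definition no_susp_summand X : Prop :=
  forall A, in_add T A -> forall (a : hom (susp S A) X) (b : hom X (susp S A)),
  is_iso (idm (susp S A) + b \oc a).

Lemma no_susp_summand_swap X A (a : hom (susp S A) X) (b : hom X (susp S A)) :
  no_susp_summand X -> in_add T A -> is_iso (idm X + a \oc b).
Proof. by move=> hX TA; apply/is_iso_1D_swap/hX. Qed.

Lemma no_susp_summand_retract X Y :
  retract Y X -> no_susp_summand X -> no_susp_summand Y.
Proof.
move=> [i [p pi]] hX A TA a b.
have := hX A TA (i \oc a) (b \oc p).
by rewrite -!compmA (compmA p) pi comp1m.
Qed.

Lemma no_susp_summand_zob : no_susp_summand zob.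
Proof.
by move=> A TA a b; rewrite (hom_from_zob b) comp0m addr0; apply: is_iso_id.
Qed.

(** With [b a = b1 a1 + b2 a2] and [u = 1 + b1 a1] invertible, [1 + b a = u (1 + u' b2 a2)], a
    product of two invertible maps. *)
Lemma no_susp_summand_bip X Y :
  no_susp_summand X -> no_susp_summand Y -> no_susp_summand (X \(+) Y).
Proof.
move=> hX hY A TA a b.
have hu := hX A TA (prl X Y \oc a) (b \oc inl_ X Y); have [u' [u1 u2]] := hu.
have hv := hY A TA (prr X Y \oc a) (u' \oc (b \oc inr_ X Y)).
suff -> : idm (susp S A) + b \oc a =
    (idm (susp S A) + (b \oc inl_ X Y) \oc (prl X Y \oc a)) \oc
    (idm (susp S A) + (u' \oc (b \oc inr_ X Y)) \oc (prr X Y \oc a)).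
  exact: is_iso_comp.
set u := idm _ + _ \oc (prl X Y \oc a) in u1 u2 *.
rewrite compmDr compm1 compmA (compmA u) u2 comp1m /u -addrA; congr (_ + _).
rewrite -!compmA -compmDr; congr (b \oc _).
by rewrite !compmA -compmDl bip_split comp1m.
Qed.

Lemma no_susp_summand_in_add X Y :
  in_add X Y -> no_susp_summand X -> no_susp_summand Y.
Proof.
move=> XY hX; elim/in_add_ind: Y / XY => // [|A B|A B hA r].
- exact: no_susp_summand_zob.
- exact: no_susp_summand_bip.
- exact: no_susp_summand_retract r hA.
Qed.

Lemma no_susp_summand_decomposition X : exists X' P,
  [/\ no_susp_summand X', in_add T P & iso X (X' \(+) susp S P)].
Proof.
have [n] := ubnP (\dim (fullv : {vspace hom X X})); elim: n X => // n IH X nX.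
have [hX|nhX] := classic (no_susp_summand X).
  exists X, zob; split=> //; first exact: in_add_zob.
  by apply/iso_bip0/susp_zero/iso_refl.
have [A [TA [a [b nab]]]] : exists A, in_add T A /\
    exists (a : hom (susp S A) X) (b : hom X (susp S A)),
      ~ is_iso (idm (susp S A) + b \oc a).
  apply: NNPP => h; apply: nhX => A TA a b; apply: NNPP => nab; apply: h.
  by exists A; split=> //; exists a, b.
have [w [yy y0]] := non_iso_1D nab.
(* The nonzero idempotent [b w] of [S A] descends along [S] to [A] and splits there. Its image [B]
   lies in [add T], and [S B] is a nonzero retract of [X]. *)
have [y ey] := suspm_surj (b \oc w).
have {}yy : y \oc y = y by apply: (suspm_inj (S := S)); rewrite suspm_comp -ey yy.
have [B [p [i [pi ip]]]] := hsplit yy.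
have r : retract (susp S B) X.
  exists (w \oc suspm S i), (suspm S p \oc b).
  rewrite -compmA (compmA b) ey -!suspm_comp -ip -compmA pi compm1 pi.
  by rewrite suspm_id.
have TB : in_add T B by apply: (in_add_retract hsplit TA); exists i, p.
have nB : ~ is_zero_obj (susp S B).
  move=> /zero_objP B0; apply: y0; rewrite ey -ip suspm_comp.
  by rewrite -[suspm S p]comp1m B0 comp0m compm0.
have [Z e] := retract_complement hsplit r.
have e' := iso_trans (iso_sym e) (iso_bipC _ _).
have [|X' [P [hX' TP eZ]]] := IH Z; first exact: leq_trans (dim_end_bip e' nB) _.
exists X', (P \(+) B); split=> //; first exact: in_add_bip.
apply: iso_trans e' _; apply: iso_trans (iso_bip eZ (iso_refl _)) _.
apply: iso_trans (iso_sym (iso_bipA _ _ _)) _.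
exact: iso_bip (iso_refl _) (susp_bip_iso S P B).
Qed.

(** The round trip of [S P] through [S Q] is the identity minus the round trip through [Y], hence
    invertible; likewise from [S Q]. *)
Lemma no_susp_summand_cancel X Y P Q :
  no_susp_summand X -> no_susp_summand Y -> in_add T P -> in_add T Q ->
  iso (X \(+) susp S P) (Y \(+) susp S Q) -> iso P Q.
Proof.
move=> hX hY TP TQ [f [g [gf fg]]]; apply: (iso_susp (S := S)).
have key A B Z Z' (u : hom (Z \(+) susp S A) (Z' \(+) susp S B)) v :
    no_susp_summand Z' -> in_add T A -> v \oc u = idm _ ->
    is_iso ((prr Z (susp S A) \oc v \oc inr_ Z' (susp S B)) \oc
            (prr Z' (susp S B) \oc u \oc inr_ Z (susp S A))).
  move=> hZ TA vu; set e := _ \oc _.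
  have -> : e = idm _ + (prr Z (susp S A) \oc v \oc inl_ Z' (susp S B)) \oc
                    (- (prl Z' (susp S B) \oc u \oc inr_ Z (susp S A))).
    rewrite compmNr; apply/eqP; rewrite eq_sym subr_eq; apply/eqP.
    rewrite /e -!compmA -!compmDr (compmA (inr_ _ _)) (compmA (inl_ _ _)) -compmDl.
    by rewrite addrC bip_split comp1m (compmA v) vu comp1m prr_inr.
  exact: hZ.
exists (prr Y (susp S Q) \oc f \oc inr_ X (susp S P)).
apply: is_iso_cross; [exact: key hY TP gf | exact: key hX TQ fg].
Qed.

Lemma copies_susp P n : retract (copies (susp S P) n) (susp S (copies P n)).
Proof.
elim: n => [|n IH]; first exact: retract_zob.
apply: retract_trans (iso_retract (susp_bip_iso S P (copies P n))).
exact: retract_bip (retract_refl _) IH.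
Qed.

Lemma in_add_susp P Q : in_add (susp S P) (susp S Q) <-> in_add P Q.
Proof.
split=> [/in_add_copies[n r]|PQ].
  apply/(in_addP hsplit); exists n.
  have [i [p pi]] := retract_trans r (copies_susp P n).
  have [i' ei] := suspm_surj i; have [p' ep] := suspm_surj p.
  exists i', p'; apply: (suspm_inj (S := S)).
  by rewrite suspm_comp suspm_id -ei -ep.
elim/in_add_ind: Q / PQ => [||A B hA hB|A B hA r].
- apply: in_add_iso (in_add_zob _); apply/iso_sym/susp_zero/iso_refl.
- exact: in_add_refl.
- exact: (in_add_iso (susp_bip_iso S A B) (in_add_bip hsplit hA hB)).
- exact: (in_add_retract hsplit hA (susp_retract S r)).
Qed.

(* In a retraction of S Q onto objects of add X and add (S P), the component of
   the identity through add X is in the radical, so the other is invertible. *)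
Lemma in_add_susp_cancel X P Q : no_susp_summand X -> in_add T Q ->
  in_add (X \(+) susp S P) (susp S Q) -> in_add P Q.
Proof.
move=> hX TQ /(in_add_bip_split hsplit)[A [B [XA PB [i [p pi]]]]].
have hA := no_susp_summand_in_add XA hX.
apply/in_add_susp; apply: (in_add_retract hsplit PB).
have := hA Q TQ (- (prl A B \oc i)) (p \oc inl_ A B).
rewrite compmNr -{1}pi.
have -> : p \oc i - p \oc inl_ A B \oc (prl A B \oc i)
    = p \oc inr_ A B \oc (prr A B \oc i).
  apply/eqP; rewrite subr_eq -!compmA -compmDr (compmA (inr_ _ _)) (compmA (inl_ _ _)).
  by rewrite -compmDl addrC bip_split comp1m.
move=> [r [r1 _]]; exists (prr A B \oc i), (r \oc (p \oc inr_ A B)).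
by rewrite -compmA.
Qed.

End NoSuspSummand.

Section HomChain.
Variables (k : fieldType) (C : addcat k) (T : C).
Implicit Types X Y Z W : C.
Notation H := (homT T).
Notation mod := (modcat (end_alg T)).

Fixpoint Hchain m X Y : chain m X Y -> @chain k mod m (H X) (H Y) :=
  match m return chain m X Y -> @chain k mod m (H X) (H Y) with
  | 0 => fun f => Hmap T f
  | m'.+1 => fun c => link (Hmap T (projT2 c).1) (Hchain (projT2 c).2)
  end.

Lemma lker_head_Hchain m X Y (c : chain m X Y) (x : hom T X) :
  x \in lker (mfun (head (Hchain c) : homM (H X) _)) <-> head c \oc x = 0.
Proof.
case: m c => [|m] c; rewrite memv_ker.
  by split=> [/eqP|e]; [|apply/eqP]; rewrite (HmapE (c : hom X Y)).
by split=> [/eqP|e]; [|apply/eqP]; rewrite (HmapE (projT2 c).1).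
Qed.

Lemma exact_chain_head m X Y Z W (f : hom X Y) (c : chain m Y Z) (h : hom Z W) :
  exact_chain f (snoc c h) -> exact_at f (head c).
Proof. by case: m c => [|m] c /exact_chain_link[]. Qed.

Lemma limg_Hmap_head m W X Y (g : hom W X) (c : chain m X Y) :
  exact_at g (head c) ->
  limg (mfun (Hmap T g : homM (H W) (H X)))
  = lker (mfun (head (Hchain c) : homM (H X) _)).
Proof.
move=> [gc cov _]; apply/vspaceP => y.
apply/idP/idP => [/memv_imgP[x _ ->]|/lker_head_Hchain/cov[u ->]].
  by apply/lker_head_Hchain; rewrite (HmapE g) compmA gc comp0m.
by rewrite -(HmapE g) memv_img ?memvf.
Qed.

(** Weak kernels become exactness under Hom (T, -). The augmentation is onto because every map
    [T -> Z] vanishes; in use, [Z] is [S T_d]. *)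
Lemma Hchain_resolution m W X Y Z (f : hom W X) (c : chain m X Y) (h : hom Y Z) :
  all_sources (in_add T) c -> exact_chain f (snoc c h) ->
  (forall x : hom T Z, x = 0) -> resolution (Hchain c).
Proof.
elim: m W X f c => [|m IH] W X f c.
  move=> TX /exact_chain_link[_ /exact_chain0[_ cov _]] Z0.
  split; first exact: Hmap_proj.
  apply/surjMP => y; have [u ->] := cov _ (y : hom T Y) (Z0 _).
  by exists u; rewrite (HmapE (c : hom X Y)).
case: c => V [g c] [TX Tc] /exact_chain_link[_ ec] Z0; split; first exact: Hmap_proj.
  exact: limg_Hmap_head (exact_chain_head ec).
exact: IH Tc ec Z0.
Qed.
End HomChain.

(** * Cluster tilting objects *)

Section ClusterTilting.
Variables (k : fieldType) (C : addcat k) (d : nat) (S : angulation C d.+1).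
Hypotheses (hsplit : split_idempotents C) (hCY : calabi_yau_2d S).
Variable T : C.
Hypothesis hT : OT_cluster_tilting S T.
Implicit Types X Y Z W A B P Q : C.
Notation H := (homT T).
Notation mod := (modcat (end_alg T)).
Notation SS := (susp S).

(** Exactness at the suspended end is invisible in the angle and is read off its rotation. The
    projections match the way the rotated sequence is taken apart. *)
Lemma exact_chain_rotated m X Y Z W (c : chain m X Y) (h : hom Y Z) (g : hom Z W) :
  exact_chain (m := m.+1) (projT2 (snoc (snoc c h) g)).1 (projT2 (snoc (snoc c h) g)).2 ->
  exact_at h g.
Proof.
case: m c => [|m] c; first by move=> /exact_chain_link[_ /exact_chain0].
exact: exact_snoc2.
Qed.

Lemma Ext_zero_T A B : in_add T A -> in_add T B -> Ext_zero S A B.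
Proof. by case: hT => rT _ TA TB; apply: Ext_zero_in_add TA TB rT. Qed.

(** Collects both ends of the resolving angle: [D] and the connecting map [h] serve for tau and for
    factoring through [S Td], while [p] and [q] present [Y] and give fullness of [H]. *)
Lemma OT_presentation Y : exists (Td Z : C) (D : hom Td Z) (c : chain d Z Y)
    (T1 T0 : C) (p : hom T1 T0) (q : hom T0 Y) (h : hom Y (SS Td)),
  [/\ [/\ in_add T Td, in_add T Z, in_add T T1 & in_add T T0],
      exact_at p q, exact_at q h, exact_at h (suspm S D)
    & resolution (Hchain T (link D c))].
Proof.
have [_ /(_ Y)[Td [c [h [Tc ang]]]]] := hT.
case: c => [Z [D c]] in Tc ang *; case: Tc => [TTd Tc].
have e := angle_exact ang.
have e' : exact_at h ((-1) ^+ d.+3 *: suspm S D).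
  have := angle_rot ang; case er : (snoc _ _) => [V [a r]] ar.
  by apply: (@exact_chain_rotated _ _ _ _ _ c); rewrite er; apply: angle_exact.
have [T1 [T0 [p [q [TT1 TT0 pq qh]]]]] := all_sources_snoc_last Tc TTd e.
exists Td, Z, D, c, T1, T0, p, q, h; split=> //.
- by split=> //; case: (d) c Tc {ang e e'} => [|?] c => [|[]].
- have s0 : ((-1) ^+ d.+3 : k) != 0 by rewrite signr_eq0.
  by have [+ _] := exact_at_scale h (suspm S D) s0; apply.
- split; [exact: Hmap_proj | exact: limg_Hmap_head (exact_chain_head e) |].
  exact: Hchain_resolution Tc e (Ext_zero_T (in_add_refl T) TTd).
Qed.

Definition no_factor X Y : Prop :=
  forall A, in_add T A -> forall (a : hom X (SS A)) (b : hom (SS A) (SS Y)),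
  b \oc a = 0.

(** Lift [phi] composed with [H q] to [g] on [T0]; then [g p = 0], so [g = u q]. As maps from [T] to
    [S Td] vanish, [H q] is onto and [H u = phi]. *)
Lemma Hmap_lift X Y (phi : @hom k mod (H X) (H Y)) : exists u, phi = Hmap T u.
Proof.
have [Td [Z [D [c [T1 [T0 [p [q [h [[TTd _ TT1 TT0] pq qh _ _]]]]]]]]]] := OT_presentation X.
have [g eg] := Hmap_full_add (phi \oc Hmap T q) TT0.
have gp : g \oc p = 0.
  apply: (Hmap_faithful TT1); rewrite Hmap_comp -eg -compmA -Hmap_comp.
  by case: pq => -> _ _; rewrite Hmap0 compm0.
have [_ _ /(_ _ _ gp)[u eu]] := pq.
exists u; apply: Hmap_ext => x.
have [_ /(_ _ x) cov _] := qh.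
have [|y ->] := cov; first exact: (Ext_zero_T (in_add_refl T) TTd (h \oc x)).
by have := mfun_eq (y : H T0) eg; rewrite (compME phi) !HmapE eu compmA.
Qed.

(** [u q = 0] by faithfulness on [T0], and [h] is a weak cokernel of [q]. *)
Lemma Hmap_kernel X Y (u : hom X Y) : Hmap T u = 0 ->
  exists A, in_add T A /\ exists (a : hom X (SS A)) (b : hom (SS A) Y), u = b \oc a.
Proof.
have [Td [Z [D [c [T1 [T0 [p [q [h [[TTd _ _ TT0] _ qh _ _]]]]]]]]]] := OT_presentation X.
move=> u0; exists Td; split=> //; exists h.
have [_ _] := qh; apply; apply: (Hmap_faithful TT0).
by rewrite Hmap_comp u0 comp0m.
Qed.

(** Lifts of inverse maps compose to the identity plus a map through [add (S T)], which is
    invertible by [no_susp_summand_swap]. *)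
Lemma Hmap_reflect_iso X Y :
  no_susp_summand S T X -> no_susp_summand S T Y -> isoM (H X) (H Y) -> iso X Y.
Proof.
move=> hX hY [phi [psi [e1 e2]]].
have [u eu] := Hmap_lift phi; have [v ev] := Hmap_lift psi.
have key A B (f : hom A B) (g : hom B A) : no_susp_summand S T A ->
    Hmap T g \oc Hmap T f = idm (H A : mod) -> is_iso (g \oc f).
  move=> hA gf; have [|A' [TA' [a [b e]]]] := @Hmap_kernel _ _ (g \oc f - idm A).
    by rewrite HmapB Hmap_comp gf Hmap_id subrr.
  rewrite -[g \oc f](subrK (idm A)) e addrC.
  exact: no_susp_summand_swap hA TA'.
exists u; apply: (is_iso_cross (g := v)); apply: key => //; by rewrite -eu -ev.
Qed.

Lemma Hmap_in_add_reflect X Y :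
  no_susp_summand S T Y -> addM (H X) (H Y) -> in_add X Y.
Proof.
move=> hY /in_add_copies[n r].
have [i [p pi]] : @retract k mod (H Y) (H (copies X n)).
  exact: retract_trans r (Hmap_copies T X n).
have [i' ei] := Hmap_lift i; have [p' ep] := Hmap_lift p.
have [|A [TA [a [b e]]]] := @Hmap_kernel _ _ (p' \oc i' - idm Y).
  by rewrite HmapB Hmap_comp -ei -ep pi Hmap_id subrr.
have [r' [r1 _]] : is_iso (p' \oc i').
  rewrite -[p' \oc i'](subrK (idm Y)) e addrC; exact: no_susp_summand_swap hY TA.
apply/(in_addP hsplit); exists n, i', (r' \oc p'); by rewrite -compmA.
Qed.

Lemma Hmap_in_add_T P Q : in_add T P -> in_add T Q ->
  addM (H P) (H Q) -> in_add P Q.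
Proof.
move=> TP TQ /in_add_copies[n r].
have [i [p pi]] : @retract k mod (H Q) (H (copies P n)).
  exact: retract_trans r (Hmap_copies T P n).
have [i' ei] := Hmap_lift i; have [p' ep] := Hmap_lift p.
apply/(in_addP hsplit); exists n, i', p'; apply/eqP; rewrite -subr_eq0; apply/eqP.
by apply: (Hmap_faithful TQ); rewrite HmapB Hmap_comp -ei -ep pi Hmap_id subrr.
Qed.

Lemma Hmap_iso_T P Q : in_add T P -> in_add T Q -> isoM (H P) (H Q) -> iso P Q.
Proof.
move=> TP TQ [phi [psi [e1 e2]]].
have [u eu] := Hmap_full_add phi TP; have [v ev] := Hmap_full_add psi TQ.
exists u, v; split; apply/eqP; rewrite -subr_eq0; apply/eqP.
  by apply: (Hmap_faithful TP); rewrite HmapB Hmap_comp -eu -ev e1 Hmap_id subrr.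
by apply: (Hmap_faithful TQ); rewrite HmapB Hmap_comp -eu -ev e2 Hmap_id subrr.
Qed.

Lemma Hom_zero_T P X : in_add T P -> Ext_zero S (SS P) X <-> Hom_zero (H P) (H X).
Proof.
move=> TP; split=> h f.
  have [g ->] := Hmap_full_add f TP; suff -> : g = 0 by exact: Hmap0.
  by apply: (suspm_eq0 (S := S)); apply: h.
have [g ->] := suspm_surj f; suff -> : g = 0 by exact: suspm0.
by apply: (Hmap_faithful TP); apply: h.
Qed.

Lemma Hom_tau_zero_no_factor X Y M N :
  no_susp_summand S T Y -> isoM (H X) M -> isoM (H Y) N ->
  Hom_tau_zero d.+1 M N <-> no_factor Y X.
Proof.
move=> hY HXM HYN.
have [Td [Z [D [c [T1 [T0 [p [q [h [[TTd TZ _ TT0] _ qh hD rc]]]]]]]]]] := OT_presentation Y.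
have [_ _ con] := hD; have [_ _ con'] := qh.
rewrite (Hom_tau_zeroP M rc (iso_sym HYN)); last first.
  move=> t; have [e ->] := Hmap_full_add t TTd => De.
  rewrite -Hmap_id -HmapB; apply: Hmap_is_iso; apply/(suspm_iso S).
  have {}De : D \oc e = 0 by apply: (Hmap_faithful TTd); rewrite Hmap_comp.
  (* The assumption on [Y] enters here: [S D] kills [S e], so [S e = h u] with [u : S Td -> Y], and
     [1 - h u] is invertible. *)
  have [_ cov _] := hD; have [|u eu] := cov _ (suspm S e).
    by rewrite -suspm_comp De suspm0.
  rewrite suspmB suspm_id eu -compmNr; exact: hY.
split=> [fc A TA a b|nf].
  (* [a q] is zero by rigidity, so [a] factors through [h]. It remains to see that a map [S g] on
     [S Td] kills [h], which holds once [g] extends along [D]. *)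
  have [a' ->] : exists a', a = a' \oc h.
    by apply: con'; apply: (Ext_zero_T TT0 TA).
  have [g eg] := suspm_surj (b \oc a'); rewrite compmA eg.
  have [g' eg'] := factors_head_iso (iso_sym HXM) fc (Hmap T g).
  have [g'' eg''] := Hmap_full_add (g' : @hom k mod (H Z) (H X)) TZ.
  have -> : g = g'' \oc D.
    apply/eqP; rewrite -subr_eq0; apply/eqP; apply: (Hmap_faithful TTd).
    by rewrite HmapB Hmap_comp -eg'' eg' subrr.
  by rewrite suspm_comp -compmA; case: hD => -> _ _; rewrite compm0.
apply: factors_head_iso HXM _ => f.
have [g ->] := Hmap_full_add f TTd.
(* The composite of [h] with [S g] passes through [S Td], so it vanishes; exactness at [S Td] then
   extends [g] along [D]. *)
have [u] := con _ (suspm S g) (nf _ TTd _ _).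
have [v ->] := suspm_surj u; rewrite -suspm_comp => /suspm_inj ->.
by exists (Hmap T v); rewrite Hmap_comp.
Qed.

Lemma Ext_zero_no_factor X Y :
  Ext_zero S X Y <-> no_factor X Y /\ no_factor Y X.
Proof.
split=> [XY|[nXY nYX] f].
  split=> A TA a b; first exact: XY.
  by move/(Ext_zero_sym hCY): XY; apply.
have [Td [Z [D [c [T1 [T0 [p [q [h [[TTd _ _ TT0] _ qh _ _]]]]]]]]]] := OT_presentation Y.
have [Ud [Z' [D' [c' [U1 [U0 [p' [q' [h' [[TUd _ _ TU0] _ qh' _ _]]]]]]]]]] := OT_presentation X.
have hf : suspm S h \oc f = 0.
  (* A functional [phi] on Hom (X, S S Td) comes from some [Td -> X]. By naturality its value on
     [S h f] is [theta] of [f] evaluated at the suspension of a composite [Y -> S Td -> S X], which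
     is zero by [nYX]. *)
  have [theta [bij nat1 nat2]] := hCY.
  apply/eqP; apply: contraT; rewrite -memv0.
  move=> /separating_functional[phi [+ _]]; apply: contraNT => _.
  have [g' _ gK] := bij Td X; rewrite -(gK phi) -nat1 nat2 -suspm_comp.
  by rewrite (nYX _ TTd) suspm0 linear0.
have fq : f \oc q' = 0.
  (* Since [S h f = 0], the map [f q'] lifts along [S q] to a map [U0 -> S T0], zero by rigidity. So
     [f] factors through [h'], and [nXY] applies. *)
  have [_ cov _] := (exact_susp S q h).2 qh.
  have [|u ->] := cov _ (f \oc q'); first by rewrite compmA hf comp0m.
  by rewrite (Ext_zero_T TU0 TT0 u) compm0.
have [_ _ /(_ _ _ fq)[u ->]] := qh'.
exact: nXY.
Qed.

End ClusterTilting.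

(** * Bijections between sets of isomorphism classes *)

Section Classes.
Variables (O1 O2 : Type) (R1 : O1 -> O1 -> Prop) (R2 : O2 -> O2 -> Prop).
Variables (P1 : O1 -> Prop) (P2 : O2 -> Prop) (Rel : O1 -> O2 -> Prop).

Lemma class_rep (O : Type) (R : O -> O -> Prop) (P : O -> Prop) (K : classes_of R P) :
  {x | P x /\ sval K = R x}.
Proof.
apply: constructive_indefinite_description.
by case: K => K [x Px KR]; exists x.
Qed.

Definition mk_class (O : Type) (R : O -> O -> Prop) (P : O -> Prop) x (Px : P x) :
  classes_of R P := exist _ (R x) (ex_intro2 _ _ x Px erefl).

Lemma class_eq (O : Type) (R : O -> O -> Prop) (P : O -> Prop)
    (K K' : classes_of R P) : sval K = sval K' -> K = K'.
Proof.
by case: K K' => [K h] [K' h'] /= e; subst K'; congr exist; apply: proof_irrelevance.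
Qed.

Hypothesis refl1 : forall x, R1 x x.
Hypothesis sym1 : forall x y, R1 x y -> R1 y x.
Hypothesis trans1 : forall y x z, R1 x y -> R1 y z -> R1 x z.
Hypothesis refl2 : forall x, R2 x x.
Hypothesis sym2 : forall x y, R2 x y -> R2 y x.
Hypothesis trans2 : forall y x z, R2 x y -> R2 y z -> R2 x z.
Hypothesis tot1 : forall x, P1 x -> exists y, P2 y /\ Rel x y.
Hypothesis tot2 : forall y, P2 y -> exists x, P1 x /\ Rel x y.
Hypothesis compat : forall x y x' y', Rel x y -> Rel x' y' -> (R1 x x' <-> R2 y y').

Lemma rel_ext (O : Type) (R : O -> O -> Prop) :
  (forall x y, R x y -> R y x) -> (forall y x z, R x y -> R y z -> R x z) ->
  forall x y, R x y -> R x = R y.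
Proof.
move=> Rs Rt x y xy; apply: functional_extensionality => z.
by apply: propositional_extensionality; split; apply: Rt => //; apply: Rs.
Qed.

(** Both maps choose a representative and then a related object; [compat] makes the resulting class
    independent of the choices, so they are mutually inverse. *)
Lemma classes_bijection :
  exists f : classes_of R1 P1 -> classes_of R2 P2, bijective f.
Proof.
have c1 x : P1 x -> {y | P2 y /\ Rel x y}.
  by move=> /tot1; apply: constructive_indefinite_description.
have c2 y : P2 y -> {x | P1 x /\ Rel x y}.
  by move=> /tot2; apply: constructive_indefinite_description.
pose F (K : classes_of R1 P1) := let: exist x (conj Px _) := class_rep K in
  let: exist y (conj Py _) := c1 x Px in mk_class R2 Py.
pose G (K : classes_of R2 P2) := let: exist y (conj Py _) := class_rep K in
  let: exist x (conj Px _) := c2 y Py in mk_class R1 Px.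
exists F, G => K; apply: class_eq; rewrite /F /G.
- case: (class_rep K) => x [Px ->]; case: (c1 x Px) => y [Py xy].
  case: (class_rep _) => y' [Py' /= e]; case: (c2 y' Py') => x' [Px' xy'] /=.
  apply: (rel_ext sym1 trans1); apply/(compat xy' xy); apply: sym2.
  by rewrite e.
- case: (class_rep K) => y [Py ->]; case: (c2 y Py) => x [Px xy].
  case: (class_rep _) => x' [Px' /= e]; case: (c1 x' Px') => y' [Py' xy'] /=.
  apply: (rel_ext sym2 trans2); apply/(compat xy' xy); apply: sym1.
  by rewrite e.
Qed.
End Classes.

(** * The correspondence *)

Section Correspondence.
Variables (k : fieldType) (C : addcat k) (d : nat) (S : angulation C d.+1).
Hypotheses (hsplit : split_idempotents C) (hCY : calabi_yau_2d S).
Variable T : C.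
Hypothesis hT : OT_cluster_tilting S T.
Implicit Types X Y Z W A B P Q : C.
Notation H := (homT T).
Notation mod := (modcat (end_alg T)).

Lemma isoM_refl (M : rmod (end_alg T)) : isoM M M.
Proof. exact: (@iso_refl k mod). Qed.

Lemma isoM_sym (M N : rmod (end_alg T)) : isoM M N -> isoM N M.
Proof. exact: (@iso_sym k mod). Qed.

Lemma isoM_trans (M N L : rmod (end_alg T)) : isoM M N -> isoM N L -> isoM M L.
Proof. exact: (@iso_trans k mod). Qed.

Lemma addM_iso (M M' N N' : rmod (end_alg T)) :
  isoM M M' -> isoM N N' -> addM M N -> addM M' N'.
Proof.
move=> MM' NN' MN; apply: (in_add_trans (@mod_split_idempotents k _)) (in_add_iso NN' MN).
exact: in_add_iso (isoM_sym MM') (@in_add_refl k mod M').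
Qed.

Lemma Hom_zero_iso (M M' N N' : rmod (end_alg T)) :
  isoM M M' -> isoM N N' -> Hom_zero M N -> Hom_zero M' N'.
Proof.
move=> [a [a' [_ aa]]] [b [b' [_ bb]]] MN f.
have e : (b' \oc (f : @hom k mod M' N') \oc a) = 0 by apply: MN.
transitivity (b \oc (b' \oc (f : @hom k mod M' N') \oc a) \oc a').
  by rewrite -!compmA aa compm1 compmA bb comp1m.
by rewrite e compm0 comp0m.
Qed.

Lemma Hmap_susp_T X P : in_add T P -> isoM (H X) (H (X \(+) susp S P)).
Proof.
move=> TP; apply: isoM_trans (Hmap_bip T X (susp S P)).
apply: (@iso_bip0 k mod); apply: Hmap_zero.
exact: (Ext_zero_T hT (in_add_refl T) TP).
Qed.

(** A relation and not a function: the decomposition of [X] is unique only up to isomorphism, and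
    every pair isomorphic to the one it yields must be reached. *)
Definition corresponds X (p : rmod (end_alg T) * rmod (end_alg T)) : Prop :=
  exists X' P, [/\ no_susp_summand S T X', in_add T P, iso X (X' \(+) susp S P),
                   isoM (H X') p.1 & isoM (H P) p.2].

Lemma corresponds_l X : exists p, corresponds X p.
Proof.
have [X' [P [hX TP e]]] := @no_susp_summand_decomposition _ _ _ S T hsplit X.
by exists (H X', H P), X', P; split=> //; apply: isoM_refl.
Qed.

(** The part of [X0] in [add (S T)] is invisible to [H], so it may be discarded and replaced by
    [S P]. *)
Lemma corresponds_r (M Q : rmod (end_alg T)) : homT_image M -> projective Q ->
  exists X, corresponds X (M, Q).
Proof.
move=> [X0 e0] /(proj_is_H hsplit)[P [TP eP]].
have [X' [P' [hX TP' e]]] := @no_susp_summand_decomposition _ _ _ S T hsplit X0.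
exists (X' \(+) susp S P), X', P; split=> //; first exact: iso_refl.
apply: isoM_trans e0; apply: isoM_trans (Hmap_susp_T X' TP') _.
exact/isoM_sym/Hmap_iso.
Qed.

Lemma corresponds_add X p Y q : corresponds X p -> corresponds Y q ->
  in_add X Y <-> addM p.1 q.1 /\ addM p.2 q.2.
Proof.
move=> [X' [P [hX TP eX eM eP]]] [Y' [Q [hY TQ eY eN eQ]]].
have XX' : in_add X (X' \(+) susp S P) by exact: in_add_iso eX (in_add_refl X).
split=> [XY|[MN PQ]].
  have XY' : in_add (X' \(+) susp S P) (Y' \(+) susp S Q).
    apply: (in_add_trans hsplit) (in_add_iso eY XY).
    exact: in_add_iso (iso_sym eX) (in_add_refl _).
  split; last first.
    apply: addM_iso eP eQ (Hmap_in_add T _); apply: (in_add_susp_cancel hsplit hX TQ).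
    exact: (in_add_retract hsplit XY' (retract_bip_r _ _)).
  have := Hmap_in_add T XY'; apply: addM_iso.
    exact: isoM_trans (isoM_sym (Hmap_susp_T X' TP)) eM.
  exact: isoM_trans (isoM_sym (Hmap_susp_T Y' TQ)) eN.
apply: in_add_iso (iso_sym eY) _; apply: (in_add_bip hsplit).
  apply: (in_add_trans hsplit) (in_add_retract hsplit XX' (retract_bip_l _ _)) _.
  apply: (Hmap_in_add_reflect hsplit hT hY); exact: addM_iso (isoM_sym eM) (isoM_sym eN) MN.
apply: (in_add_trans hsplit) (in_add_retract hsplit XX' (retract_bip_r _ _)) _.
apply/(in_add_susp S hsplit); apply: (Hmap_in_add_T hsplit hT TP TQ).
exact: addM_iso (isoM_sym eP) (isoM_sym eQ) PQ.
Qed.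

Lemma corresponds_iso X p Y q : corresponds X p -> corresponds Y q ->
  iso X Y <-> iso_pair p q.
Proof.
move=> [X' [P [hX TP eX eM eP]]] [Y' [Q [hY TQ eY eN eQ]]].
split=> [XY|[MN PQ]].
  have XY' := iso_trans (iso_trans (iso_sym eX) XY) eY.
  split.
    apply: isoM_trans (isoM_sym eM) _; apply: isoM_trans eN.
    apply: isoM_trans (Hmap_susp_T X' TP) _.
    apply: isoM_trans (Hmap_iso T XY') (isoM_sym (Hmap_susp_T Y' TQ)).
  apply: isoM_trans (isoM_sym eP) _; apply: isoM_trans eQ.
  exact/Hmap_iso/(no_susp_summand_cancel hX hY TP TQ XY').
have X'Y' : iso X' Y'.
  apply: (Hmap_reflect_iso hT hX hY).
  exact: isoM_trans (isoM_trans eM MN) (isoM_sym eN).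
apply: iso_trans eX _; apply: iso_trans _ (iso_sym eY).
apply: iso_bip X'Y' (susp_iso S _); apply: (Hmap_iso_T TP TQ).
exact: isoM_trans (isoM_trans eP PQ) (isoM_sym eQ).
Qed.

(** Ext splits into four components. The one between [X'] and [Y'] gives the two tau conditions, and
    Ext (S P', Y') is Hom (P', Y'). Symmetry turns Ext (X', S Q') into Hom (Q', X'), and Ext (S P',
    S Q') vanishes by rigidity of [T]. *)
Lemma corresponds_Ext X Y (M P N Q : rmod (end_alg T)) : corresponds X (M, P) -> corresponds Y (N, Q) ->
  Ext_zero S X Y <-> [/\ Hom_tau_zero d.+1 M N, Hom_tau_zero d.+1 N M,
                         Hom_zero P N & Hom_zero Q M].
Proof.
move=> [X' [P' [hX TP eX eM eP]]] [Y' [Q' [hY TQ eY eN eQ]]].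
have -> : Ext_zero S X Y <-> Ext_zero S (X' \(+) susp S P') (Y' \(+) susp S Q').
  split; apply: Ext_zero_retract; apply: iso_retract => //; exact: iso_sym.
have hz A B (L K : rmod (end_alg T)) :
    isoM (H A) L -> isoM (H B) K -> Hom_zero (H A) (H B) <-> Hom_zero L K.
  move=> AL BK; split; apply: Hom_zero_iso => //; exact: isoM_sym.
have e1 := Hom_tau_zero_no_factor hT hY eM eN.
have e2 := Hom_tau_zero_no_factor hT hX eN eM.
have e3 := iff_trans (Hom_zero_T S Y' TP) (hz _ _ _ _ eP eN).
have e4 := iff_trans (Ext_zero_sym hCY X' (susp S Q'))
                     (iff_trans (Hom_zero_T S X' TQ) (hz _ _ _ _ eQ eM)).
have e5 := Ext_zero_no_factor hCY hT X' Y'.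
rewrite Ext_zero_bip4.
split=> [[/e5[/e2 ? /e1 ?] /e4 ? /e3 ? _] //|[/e1 ? /e2 ? /e3 ? /e4 ?]].
split=> //; first exact/e5.
by move=> f; have [g ->] := suspm_surj f; rewrite (Ext_zero_T hT TP TQ g) suspm0.
Qed.

Hypothesis hind : forall X : C, indecomposable X -> d_rigid S X.

(** The two conditions on a pair are recovered by testing maximality on objects corresponding to (N,
    0) and to (0, Q), with [H zob] as zero module. Conversely, membership and Ext vanishing for a
    general [Y] are the conjunctions of these two cases. *)
Lemma corresponds_maximal X p : corresponds X p ->
  maximal_d_rigid S X <-> maximal_tau_rigid_pair d.+1 (@homT_image k C T) p.
Proof.
case: p => M P hXp; rewrite (maximal_d_rigidP hCY hsplit hind).
have [X' [P' [hX' TP' _ eM eP]]] := hXp.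
have zM : @is_zero_obj k mod (H zob) by apply: Hmap_zero => x; apply: hom_to_zob.
have pz : projective (H zob) by apply/Hmap_proj/in_add_zob.
have Dz : homT_image (H zob) by exists zob; apply: isoM_refl.
have addz (L : rmod (end_alg T)) : addM L (H zob).
  exact: in_add_iso (iso_sym zM) (@in_add_zob k mod L).
have Hz (L : rmod (end_alg T)) : Hom_zero (H zob) L.
  move=> f; rewrite -[LHS](compm1 (a := mod)).
  by move/zero_objP: zM => ->; apply: (compm0 (C := mod)).
have Hz' (L : rmod (end_alg T)) : Hom_zero L (H zob).
  move=> f; rewrite -[LHS](comp1m (a := mod)).
  by move/zero_objP: zM => ->; apply: (comp0m (C := mod)).
have tz : Hom_tau_zero d.+1 M (H zob).
  have := Hom_tau_zero_no_factor hT (@no_susp_summand_zob _ _ _ S T) eM (isoM_refl _).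
  move=> h; apply/h => A _ a b.
  by rewrite (hom_from_zob a) compm0.
have tz' : Hom_tau_zero d.+1 (H zob) M.
  have := Hom_tau_zero_no_factor hT hX' (isoM_refl (H zob)) eM.
  move=> h; apply/h => A _ a b.
  by rewrite (Ext_zero_zobr b) comp0m.
split=> [hX|[_ pP hM hP] Y].
  split.
  - by exists X'.
  - apply: projective_retract (Hmap_proj TP') _; exact/iso_retract/isoM_sym.
  - move=> N DN; have [Y hY] := corresponds_r DN pz.
    have := hX Y; rewrite (corresponds_add hXp hY) (corresponds_Ext hXp hY) /= => e.
    split=> [MN|[? ? ?]]; first by have [] := e.1 (conj MN (addz P)).
    by have [] : addM M N /\ addM P (H zob) by apply/e.
  - move=> Q pQ; have [Y hY] := corresponds_r Dz pQ.
    have := hX Y; rewrite (corresponds_add hXp hY) (corresponds_Ext hXp hY) /= => e.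
    split=> [PQ|?]; first by have [] := e.1 (conj (addz M) PQ).
    by have [] : addM M (H zob) /\ addM P Q by apply/e.
have [[N Q] hY] := corresponds_l Y.
have [Y' [Q' [_ TQ' _ eN eQ]]] := hY.
have DN : homT_image N by exists Y'.
have pQ : projective Q.
  apply: projective_retract (Hmap_proj TQ') _; exact/iso_retract/isoM_sym.
rewrite (corresponds_add hXp hY) (corresponds_Ext hXp hY) /= (hM N DN) (hP Q pQ).
by split=> [[[? ? ?] ?]|[? ? ? ?]].
Qed.

End Correspondence.

Theorem theoremB (k : closedFieldType) (d : nat) (hd : (0 < d)%N)
    (C : addcat k) (S : angulation C d)
    (hsplit : split_idempotents C) (hCY : calabi_yau_2d S)
    (T : C) (hT : OT_cluster_tilting S T)
    (hind : forall X : C, indecomposable X -> d_rigid S X) :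
  exists f : classes_of (@iso k C) (maximal_d_rigid S) ->
             classes_of (@iso_pair k (end_alg T))
               (maximal_tau_rigid_pair d (@homT_image k C T)),
    bijective f.
Proof.
(* Positivity of [d] becomes the successor form of the preceding sections, in which an angle has at
   least three objects before its suspended end. *)
case: d hd S hCY hT hind => // d _ S hCY hT hind.
apply: (@classes_bijection _ _ (@iso k C) (@iso_pair k (end_alg T))
  (maximal_d_rigid S) (maximal_tau_rigid_pair d.+1 (@homT_image k C T))
  (@corresponds k C d S T)).
- exact: (@iso_refl k C).
- exact: (@iso_sym k C).
- by move=> Y X Z; apply: iso_trans.
- by move=> p; split; apply: isoM_refl.
- by move=> p q [? ?]; split; apply: isoM_sym.
- by move=> q p r [? ?] [? ?]; split; apply: isoM_trans; eauto.
- move=> X; have [p hXp] := @corresponds_l _ _ _ S hsplit T X.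
  by move=> /(corresponds_maximal hsplit hCY hT hind hXp); exists p.
- move=> [M P] hp; have [DM pP _ _] := hp.
  have [X hX] := corresponds_r hsplit hT DM pP.
  by exists X; split=> //; apply/(corresponds_maximal hsplit hCY hT hind hX).
- move=> X p Y q; exact: (corresponds_iso hT).
Qed.
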